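(* Let $f$ be a slice regular function defined on a symmetric domain $\Omega_D$ and let $q_0\in\Omega_D\setminus\mathbb{R}$. Let $(s_n)_{n\ge 0}\subset\mathbb{H}$ be the spherical coefficients of $f$ at $q_0$, i.e. the coefficients of its spherical expansion $$f(x)=\sum_{n\ge 0}\Delta_{q_0}^n(x)\,[s_{2n}+(x-q_0)s_{2n+1}]$$ near $q_0$. Then, for every integer $k\ge 0$, $$s_{2k}=\frac{1}{k!}\big((\partial_c\partial_s)^k f\big)(q_0),\qquad s_{2k+1}=\frac{1}{k!}\big(\partial_s(\partial_c\partial_s)^k f\big)(q_0).$$
   Context: Quaternions: $\mathbb{H}$ is the algebra of quaternions, $x^c$ the conjugate of $x$, $\operatorname{Re}(x)=(x+x^c)/2$, $\operatorname{Im}(x)=(x-x^c)/2$ (so $\operatorname{Im}(x)$ is a purely imaginary quaternion), $\mathbb{S}=\{x\in\mathbb{H}: x^2=-1\}$. Every $x\in\mathbb{H}$ is $x=\alpha+I\beta$ with $\alpha,\beta\in\mathbb{R}$, $\beta\ge0$, $I\in\mathbb{S}$. Symmetric domains and slice functions: let $D\subset\mathbb{C}$ be open with $D=\overline{D}$ (invariant under complex conjugation; it may be disconnected, e.g. $D=\mathbb{C}\setminus\mathbb{R}$). Its circularization $\Omega_D=\{\alpha+I\beta: \alpha+i\beta\in D,\ I\in\mathbb{S}\}$ is called a symmetric domain. A stem function is $F=F_0+\sqrt{-1}F_1:D\to\mathbb{H}\otimes\mathbb{C}$ with $F_0,F_1:D\to\mathbb{H}$, $F_0(\bar z)=F_0(z)$,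 $F_1(\bar z)=-F_1(z)$. It induces the slice function $f=\mathcal{I}(F):\Omega_D\to\mathbb{H}$, $f(\alpha+I\beta)=F_0(\alpha+i\beta)+I F_1(\alpha+i\beta)$. $f$ is slice regular if $F$ is $C^1$ and holomorphic, i.e. $\partial_\alpha F_0=\partial_\beta F_1$ and $\partial_\beta F_0=-\partial_\alpha F_1$. Operators: for a slice function $f=\mathcal{I}(F)$, the spherical derivative is the slice function on $\Omega_D\setminus\mathbb{R}$ given by $(\partial_s f)(x)=(2\operatorname{Im}(x))^{-1}(f(x)-f(x^c))=F_1(\alpha+i\beta)/\beta$; if $F$ is $C^1$, the slice derivative is $\partial_c f=\mathcal{I}(\partial F/\partial z)$, i.e. $(\partial_c f)(\alpha+I\beta)=\frac12\left(\frac{\partial}{\partial\alpha}-I\frac{\partial}{\partial\beta}\right)(F_0+IF_1)(\alpha+i\beta)$. Powers such as $(\partial_c\partial_s)^k$ denote iterated composition (exponent $0$ is the identity); compositions involving $\partial_s$ are considered on $\Omega_D\setminus\mathbb{R}$. Spherical expansion: for $q_0\in\mathbb{H}\setminus\mathbb{R}$, $\Delta_{q_0}(x)=x^2-2x\operatorname{Re}(q_0)+|q_0|^2$. It is known that for $f$ slice regular on $\Omega_D$ and $q_0\in\Omega_D\setminus\mathbb{R}$ there are $r>0$ with $U(q_0,r)=\{x\in\mathbb{H}:|\Delta_{q_0}(x)|<r^2\}\subset\Omega_D$ and unique $s_n\in\mathbb{H}$ such that $f(x)=\sum_{n\ge0}\Delta_{q_0}^n(x)[s_{2n}+(x-q_0)s_{2n+1}]$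 for all $x\in U(q_0,r)$; the $s_n$ are the spherical coefficients of $f$ at $q_0$. *)

(* Defs.v *)
From HB Require Import structures.
From mathcomp Require Import all_boot all_order all_algebra.
From mathcomp Require Import ring lra.
From mathcomp Require Import all_classical all_reals all_analysis.

Set Implicit Arguments.
Unset Strict Implicit.
Unset Printing Implicit Defensive.

Import Order.TTheory GRing.Theory Num.Theory.
Import numFieldNormedType.Exports.

Local Open Scope classical_set_scope.
Local Open Scope ring_scope.

(* Carrying 'rV_4 gives derivatives and limits for free. The norm `|x| it      *)
(* inherits is the sup norm: it is equivalent to the modulus of quaternions,   *)
(* hence induces the right topology, but the modulus itself is qnorm below.    *)
Definition quat (R : realType) : Type := 'rV[R]_4.

HB.instance Definition _ (R : realType) :=
  NormedModule.copy (quat R) 'rV[R]_4.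

Section QuaternionAlgebra.
Context {R : realType}.
Implicit Types x y z : quat R.

Definition mkq (a b c d : R) : quat R :=
  \row_(i < 4) nth 0 [:: a; b; c; d] i.

Definition qc0 x : R := x ord0 (@Ordinal 4 0 isT).
Definition qc1 x : R := x ord0 (@Ordinal 4 1 isT).
Definition qc2 x : R := x ord0 (@Ordinal 4 2 isT).
Definition qc3 x : R := x ord0 (@Ordinal 4 3 isT).

Lemma qP x y : qc0 x = qc0 y -> qc1 x = qc1 y -> qc2 x = qc2 y ->
  qc3 x = qc3 y -> x = y.
Proof.
rewrite /qc0 /qc1 /qc2 /qc3 => h0 h1 h2 h3.
apply/rowP => -[[|[|[|[|//]]]] hi].
- by rewrite (bool_irrelevance hi isT).
- by rewrite (bool_irrelevance hi isT).
- by rewrite (bool_irrelevance hi isT).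
- by rewrite (bool_irrelevance hi isT).
Qed.

Definition qmul x y : quat R :=
  mkq (qc0 x * qc0 y - qc1 x * qc1 y - qc2 x * qc2 y - qc3 x * qc3 y)
      (qc0 x * qc1 y + qc1 x * qc0 y + qc2 x * qc3 y - qc3 x * qc2 y)
      (qc0 x * qc2 y - qc1 x * qc3 y + qc2 x * qc0 y + qc3 x * qc1 y)
      (qc0 x * qc3 y + qc1 x * qc2 y - qc2 x * qc1 y + qc3 x * qc0 y).

Definition qone : quat R := mkq 1 0 0 0.

Lemma qc0_mk a b c d : qc0 (mkq a b c d) = a. Proof. by rewrite /qc0 mxE. Qed.
Lemma qc1_mk a b c d : qc1 (mkq a b c d) = b. Proof. by rewrite /qc1 mxE. Qed.
Lemma qc2_mk a b c d : qc2 (mkq a b c d) = c. Proof. by rewrite /qc2 mxE. Qed.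
Lemma qc3_mk a b c d : qc3 (mkq a b c d) = d. Proof. by rewrite /qc3 mxE. Qed.
Definition qc_mk := (qc0_mk, qc1_mk, qc2_mk, qc3_mk).

Lemma qcD x y : (qc0 (x + y) = qc0 x + qc0 y) * (qc1 (x + y) = qc1 x + qc1 y) *
  (qc2 (x + y) = qc2 x + qc2 y) * (qc3 (x + y) = qc3 x + qc3 y).
Proof. by rewrite /qc0 /qc1 /qc2 /qc3 !mxE. Qed.

Lemma qcN x : (qc0 (- x) = - qc0 x) * (qc1 (- x) = - qc1 x) *
  (qc2 (- x) = - qc2 x) * (qc3 (- x) = - qc3 x).
Proof. by rewrite /qc0 /qc1 /qc2 /qc3 !mxE. Qed.

Lemma qcZ (a : R) x : (qc0 (a *: x) = a * qc0 x) * (qc1 (a *: x) = a * qc1 x) *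
  (qc2 (a *: x) = a * qc2 x) * (qc3 (a *: x) = a * qc3 x).
Proof. by rewrite /qc0 /qc1 /qc2 /qc3 !mxE. Qed.

Lemma qc_0 : (qc0 (0 : quat R) = 0) * (qc1 (0 : quat R) = 0) *
  (qc2 (0 : quat R) = 0) * (qc3 (0 : quat R) = 0).
Proof. by rewrite /qc0 /qc1 /qc2 /qc3 !mxE. Qed.

Lemma qmulA : associative qmul.
Proof. by move=> x y z; apply: qP; rewrite /qmul !qc_mk; ring. Qed.
Lemma qmul1q : left_id qone qmul.
Proof. by move=> x; apply: qP; rewrite /qmul !qc_mk; ring. Qed.
Lemma qmulq1 : right_id qone qmul.
Proof. by move=> x; apply: qP; rewrite /qmul !qc_mk; ring. Qed.
Lemma qmulDl : left_distributive qmul +%R.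
Proof. by move=> x y z; apply: qP; rewrite /qmul !(qc_mk, qcD); ring. Qed.
Lemma qmulDr : right_distributive qmul +%R.
Proof. by move=> x y z; apply: qP; rewrite /qmul !(qc_mk, qcD); ring. Qed.
Lemma qone_neq0 : qone != 0.
Proof.
apply/eqP => /(congr1 qc0); rewrite qc_mk qc_0 => /eqP.
by rewrite oner_eq0.
Qed.

HB.instance Definition _ := GRing.Zmodule_isNzRing.Build (quat R)
  qmulA qmul1q qmulq1 qmulDl qmulDr qone_neq0.

Lemma qscaleAl (a : R) x y : a *: (x * y) = (a *: x) * y.
Proof.
by apply: qP; rewrite /GRing.mul/= /qmul !(qc_mk, qcZ); ring.
Qed.
HB.instance Definition _ := GRing.Lmodule_isLalgebra.Build R (quat R) qscaleAl.

Lemma qscaleAr (a : R) x y : a *: (x * y) = x * (a *: y).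
Proof.
by apply: qP; rewrite /GRing.mul/= /qmul !(qc_mk, qcZ); ring.
Qed.
HB.instance Definition _ := GRing.Lalgebra_isAlgebra.Build R (quat R) qscaleAr.

Lemma qcM x y : (qc0 (x * y) =
     qc0 x * qc0 y - qc1 x * qc1 y - qc2 x * qc2 y - qc3 x * qc3 y) *
  (qc1 (x * y) =
     qc0 x * qc1 y + qc1 x * qc0 y + qc2 x * qc3 y - qc3 x * qc2 y) *
  (qc2 (x * y) =
     qc0 x * qc2 y - qc1 x * qc3 y + qc2 x * qc0 y + qc3 x * qc1 y) *
  (qc3 (x * y) =
     qc0 x * qc3 y + qc1 x * qc2 y - qc2 x * qc1 y + qc3 x * qc0 y).
Proof. by rewrite [x * y]/(qmul x y) !qc_mk. Qed.

Lemma qc_1 : (qc0 (1 : quat R) = 1) * (qc1 (1 : quat R) = 0) *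
  (qc2 (1 : quat R) = 0) * (qc3 (1 : quat R) = 0).
Proof. by rewrite (_ : 1 = qone)// !qc_mk. Qed.

Definition qconj x : quat R := mkq (qc0 x) (- qc1 x) (- qc2 x) (- qc3 x).

Definition qnorm x : R :=
  Num.sqrt (qc0 x ^+ 2 + qc1 x ^+ 2 + qc2 x ^+ 2 + qc3 x ^+ 2).

Definition qinv x : quat R := (qnorm x ^+ 2)^-1 *: qconj x.

Lemma qnormE x :
  qnorm x ^+ 2 = qc0 x ^+ 2 + qc1 x ^+ 2 + qc2 x ^+ 2 + qc3 x ^+ 2.
Proof. by rewrite sqr_sqrtr// !addr_ge0 ?sqr_ge0. Qed.

Lemma qnorm_eq0 x : qnorm x ^+ 2 = 0 -> x = 0.
Proof. by rewrite qnormE => h; apply: qP; rewrite qc_0; nra. Qed.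

Lemma qmulVq : {in [pred x : quat R | x != 0], left_inverse 1 qinv *%R}.
Proof.
move=> x /= /eqP x0.
have n0 : qnorm x ^+ 2 != 0 by apply/eqP => /qnorm_eq0.
move: n0; rewrite /qinv qnormE => n0.
by apply: qP; rewrite !(qcM, qc_1, qcZ, qc_mk); field.
Qed.

Lemma qmulqV : {in [pred x : quat R | x != 0], right_inverse 1 qinv *%R}.
Proof.
move=> x /= /eqP x0.
have n0 : qnorm x ^+ 2 != 0 by apply/eqP => /qnorm_eq0.
move: n0; rewrite /qinv qnormE => n0.
by apply: qP; rewrite !(qcM, qc_1, qcZ, qc_mk); field.
Qed.

Lemma qunitP x y : y * x = 1 /\ x * y = 1 -> [pred x : quat R | x != 0] x.
Proof.
move=> [yx _]; apply/eqP => x0; move: yx; rewrite x0 mulr0 => /esym/eqP.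
by rewrite oner_eq0.
Qed.

Lemma qinv_out : {in [predC [pred x : quat R | x != 0]], qinv =1 id}.
Proof.
move=> x; rewrite !inE negbK => /eqP ->.
by apply: qP; rewrite /qinv /qconj !(qcZ, qc_mk, qc_0) ?oppr0 mulr0.
Qed.

HB.instance Definition _ := GRing.NzRing_hasMulInverse.Build (quat R)
  qmulVq qmulqV qunitP qinv_out.

Definition qRe x : R := qc0 x.
Definition qIm x : quat R := 2^-1 *: (x - qconj x).

Definition qreal : set (quat R) := [set x | exists a : R, x = a%:A].

Definition qsphere : set (quat R) := [set x | x ^+ 2 = -1].

(* The complex plane is represented by R * R; qpt (a, b) I is a + I b.         *)
Definition qpt (z : R * R) (I : quat R) : quat R := z.1%:A + z.2 *: I.

(* x = qpt (qcoord x) (qdir x) with qdir x \in qsphere and 0 <= (qcoord x).2;  *)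
(* at real points, where every imaginary unit would do, qdir returns i.        *)
Definition qcoord x : R * R := (qRe x, qnorm (qIm x)).
Definition qdir x : quat R :=
  if qIm x == 0 then mkq 0 1 0 0 else (qnorm (qIm x))^-1 *: qIm x.

Lemma qdir_sphere x : qsphere (qdir x).
Proof.
rewrite /qsphere/= /qdir expr2; have [|x0] := eqVneq (qIm x) 0.
  by move=> _; apply: qP; rewrite !(qcM, qcN, qc_1, qc_mk); ring.
set u := qIm x in x0 *; have n0 : qnorm u ^+ 2 != 0.
  by apply/eqP => /qnorm_eq0 /eqP; rewrite (negbTE x0).
have u0 : qc0 u = 0 by rewrite /u /qIm !(qcZ, qcD, qcN, qc_mk) subrr mulr0.
clearbody u; rewrite -scalerAl -scalerAr scalerA -expr2.
have -> : u * u = - (qnorm u ^+ 2)%:A.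
  by rewrite qnormE; apply: qP; rewrite !(qcM, qcN, qcZ, qc_1) u0; ring.
by rewrite scalerN scalerA exprVn mulVf// scale1r.
Qed.

Lemma qpt_qdir x : qpt (qcoord x) (qdir x) = x.
Proof.
have h : x = (qRe x)%:A + qIm x.
  by apply: qP; rewrite /qIm /qRe !(qcD, qcZ, qcN, qc_1, qc_mk); field.
rewrite /qpt /qcoord /qdir /= [RHS]h; have [e|x0] := eqVneq (qIm x) 0.
  rewrite e; congr (_ + _); rewrite (_ : qnorm 0 = 0) ?scale0r//.
  by rewrite /qnorm !qc_0 expr0n !addr0 sqrtr0.
rewrite scalerA mulfV ?scale1r//; apply: contra x0 => /eqP n0.
by apply/eqP/qnorm_eq0; rewrite n0 expr0n.
Qed.

Lemma qsphere_coord I : qsphere I ->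
  qc0 I = 0 /\ qc1 I ^+ 2 + qc2 I ^+ 2 + qc3 I ^+ 2 = 1.
Proof.
rewrite /qsphere/= expr2 => II.
have := congr1 qc0 II; have := congr1 qc1 II; have := congr1 qc2 II.
have := congr1 qc3 II; rewrite !(qcM, qcN, qc_1) => h3 h2 h1 h0.
suff I0 : qc0 I = 0 by split=> //; rewrite I0 in h0; lra.
apply/eqP; apply: contraT => I0.
have aux (t : R) : qc0 I * t = 0 -> t = 0.
  by move=> /eqP; rewrite mulf_eq0 (negbTE I0)/= => /eqP.
have e1 : qc1 I = 0 by apply: aux; lra.
have e2 : qc2 I = 0 by apply: aux; lra.
have e3 : qc3 I = 0 by apply: aux; lra.
by move: h0; rewrite e1 e2 e3; nra.
Qed.

Lemma qconj_qpt (z : R * R) I : qsphere I -> qconj (qpt z I) = qpt (z.1, - z.2) I.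
Proof.
move=> /qsphere_coord[I0 _].
by apply: qP; rewrite /qconj /qpt !(qcD, qcZ, qcN, qc_1, qc_mk) ?I0/=; ring.
Qed.

Lemma qIm_qpt (z : R * R) I : qsphere I -> qIm (qpt z I) = z.2 *: I.
Proof.
move=> /[dup]/qsphere_coord[I0 _] SI; rewrite /qIm qconj_qpt//.
by apply: qP; rewrite /qpt !(qcD, qcZ, qcN, qc_1) ?I0/=; field.
Qed.

Lemma qnorm_qsphere (b : R) I : qsphere I -> 0 <= b -> qnorm (b *: I) = b.
Proof.
move=> /qsphere_coord[I0 I1] b0; rewrite /qnorm !qcZ I0.
rewrite (_ : _ + _ = b ^+ 2); first by rewrite sqrtr_sqr ger0_norm.
by rewrite -[RHS]mulr1 -I1; ring.
Qed.

Lemma qcoord_qpt (z : R * R) I : qsphere I -> 0 <= z.2 -> qcoord (qpt z I) = z.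
Proof.
move=> SI z0; rewrite /qcoord qIm_qpt// qnorm_qsphere// [RHS]surjective_pairing.
congr (_, _); have [I0 _] := qsphere_coord SI.
by rewrite /qRe /qpt !(qcD, qcZ, qc_1) ?I0; ring.
Qed.

Lemma qdir_qpt (z : R * R) I : qsphere I -> 0 < z.2 -> qdir (qpt z I) = I.
Proof.
move=> SI z0; rewrite /qdir qIm_qpt// qnorm_qsphere ?ltW//.
have I0 : I != 0.
  by apply/eqP => I0; have [_] := qsphere_coord SI; rewrite I0 !qc_0; lra.
by rewrite scaler_eq0 (negbTE I0) gt_eqF//= scalerA mulVf ?scale1r// gt_eqF.
Qed.

Lemma qmul_continuous (x : quat R) : continuous (fun y : quat R => x * y).
Proof.
pose e (i : 'I_4) : quat R := delta_mx ord0 i.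
have -> : (fun y : quat R => x * y) =
    (fun y : quat R => \sum_(i < 4) (y : 'rV[R]_4) ord0 i *: (x * e i)).
  apply/funext => y; rewrite [in LHS](row_sum_delta (y : 'rV[R]_4)).
  by rewrite mulr_sumr; apply: eq_bigr => i _; rewrite scalerAr.
apply: continuous_big => [|i _ y]; first exact: add_continuous.
by apply: continuousZr_tmp; exact: coord_continuous.
Qed.

End QuaternionAlgebra.

Section SliceFunctions.
Context {R : realType}.
Implicit Types (D : set (R * R)) (F : R * R -> quat R) (f : quat R -> quat R).

Definition cconj (z : R * R) : R * R := (z.1, - z.2).

Definition symmetric_base D : Prop := open D /\ cconj @` D = D.

Definition circularization D : set (quat R) :=
  [set x | exists z I, [/\ D z, qsphere I & x = qpt z I]].

Definition dalpha F : R * R -> quat R := fun z => 'D_((1, 0) : R * R) F z.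
Definition dbeta F : R * R -> quat R := fun z => 'D_((0, 1) : R * R) F z.

Definition C1_on D F : Prop := forall z, D z ->
  [/\ derivable F z ((1, 0) : R * R), derivable F z ((0, 1) : R * R),
      {for z, continuous (dalpha F)} & {for z, continuous (dbeta F)}].

(* A stem function F_0 + sqrt(-1) F_1 is the pair of its components.           *)
Definition stem D (F0 F1 : R * R -> quat R) : Prop := forall z, D z ->
  F0 (cconj z) = F0 z /\ F1 (cconj z) = - F1 z.

(* f = I(F_0 + sqrt(-1) F_1) on Omega_D; the values of f elsewhere are         *)
(* irrelevant.                                                                 *)
Definition induced D (F0 F1 : R * R -> quat R) f : Prop :=
  forall z I, D z -> qsphere I -> f (qpt z I) = F0 z + I * F1 z.

Definition holomorphic_stem D (F0 F1 : R * R -> quat R) : Prop :=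
  forall z, D z -> dalpha F0 z = dbeta F1 z /\ dbeta F0 z = - dalpha F1 z.

Definition slice_regular D f : Prop := exists F0 F1 : R * R -> quat R,
  [/\ stem D F0 F1, C1_on D F0, C1_on D F1, holomorphic_stem D F0 F1 &
      induced D F0 F1 f].

Definition sderiv f : quat R -> quat R :=
  fun x => (2 *: qIm x)^-1 * (f x - f (qconj x)).

(* (1/2) (d/dalpha - I d/dbeta) (F_0 + I F_1) at x = alpha + I beta; for fixed *)
(* I, the function (F_0 + I F_1)(alpha + i beta) is f (alpha + I beta). See    *)
(* cderiv_induced for the agreement with the slice function induced by dF/dz.  *)
Definition cderiv f : quat R -> quat R := fun x =>
  let I := qdir x in
  let fI := fun z : R * R => f (qpt z I) in
  2^-1 *: (dalpha fI (qcoord x) - I * dbeta fI (qcoord x)).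

Definition Delta (q x : quat R) : quat R :=
  x ^+ 2 - 2 *: (x * (qRe q)%:A) + (qnorm q ^+ 2)%:A.

Definition Uball (q : quat R) (r : R) : set (quat R) :=
  [set x | qnorm (Delta q x) < r ^+ 2].

Definition spherical_coefficients D f (q : quat R) (s : nat -> quat R) : Prop :=
  exists r : R, [/\ 0 < r, Uball q r `<=` circularization D &
    forall x, Uball q r x ->
      series (fun n => Delta q x ^+ n * (s n.*2 + (x - q) * s n.*2.+1)) @ \oo
        --> f x].

Lemma deriveMl (x : quat R) F z v : derivable F z v ->
  derivable (fun w => x * F w) z v /\ 'D_v (fun w => x * F w) z = x * 'D_v F z.
Proof.
move=> dF.
have : (fun h : R => h^-1 *: (x * F (h *: v + z) - x * F z)) @ 0^' -->
    x * 'D_v F z.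
  under eq_fun do rewrite -mulrBr scalerAr.
  exact: (cvg_comp _ _ dF (@qmul_continuous _ x _)).
by move=> h; split; [apply/cvg_ex; eexists; exact: h|exact/cvg_lim].
Qed.

Section Agreement.
Variables (D : set (R * R)) (F0 F1 : R * R -> quat R) (f : quat R -> quat R).
Hypotheses (symD : symmetric_base D) (stemF : stem D F0 F1).
Hypothesis indf : induced D F0 F1 f.

Lemma sderiv_induced z I : D z -> qsphere I -> z.2 != 0 ->
  sderiv f (qpt z I) = z.2^-1 *: F1 z.
Proof.
move=> Dz SI z0; have Dz' : D (cconj z) by rewrite -symD.2; exists z.
rewrite /sderiv qIm_qpt// qconj_qpt// -/(cconj z) !indf//.
have [-> ->] := stemF Dz.
have I0 : I \is a GRing.unit.
  by apply/unitrP; exists (- I); rewrite mulrN mulNr -expr2 SI opprK.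
rewrite mulrN opprD opprK addrACA subrr add0r -mulr2n -mulrnAr.
rewrite scalerA invrZ ?unitfE ?mulf_neq0 ?pnatr_eq0//.
have -> : F1 z *+ 2 = (2 : R) *: F1 z by rewrite scaler_nat.
by rewrite -scalerAl mulKr// scalerA invfM mulrAC mulVf ?mul1r// pnatr_eq0.
Qed.

Lemma cderiv_induced z I : C1_on D F0 -> C1_on D F1 ->
  D z -> qsphere I -> 0 < z.2 ->
  cderiv f (qpt z I) = 2^-1 *: (dalpha F0 z + dbeta F1 z)
                       + I * (2^-1 *: (dalpha F1 z - dbeta F0 z)).
Proof.
move=> C0 C1 Dz SI z0; have [a0 b0 _ _] := C0 _ Dz; have [a1 b1 _ _] := C1 _ Dz.
rewrite /cderiv qdir_qpt// qcoord_qpt ?ltW//.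
have fE : \forall w \near z, f (qpt w I) = (F0 + (fun w => I * F1 w)) w.
  near=> w; apply: indf => //; near: w; exact: open_nbhs_nbhs (conj symD.1 Dz).
rewrite /dalpha /dbeta !(near_eq_derive _ fE).
have [Ia1 da1] := deriveMl I a1; have [Ib1 db1] := deriveMl I b1.
rewrite (deriveD a0 Ia1) (deriveD b0 Ib1) da1 db1.
have II (y : quat R) : I * (I * y) = - y by rewrite mulrA -expr2 SI mulN1r.
rewrite -scalerAr -scalerDr; congr (_ *: _).
rewrite mulrDr II mulrBr opprD opprK.
rewrite [- _ + _]addrC !addrA; congr (_ - _).
exact: addrAC.
Unshelve. all: by end_near. Qed.

End Agreement.

End SliceFunctions.

(* Main.v *)
(* Write [f = F0 + I F1] near [q0 = a + J b] and [L := - (2 beta)^-1 d/dbeta],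
   the derivative in [u = - beta^2].  The spherical derivative of
   [(d_c d_s)^k f] is [L^k (F1 / beta)], which does not depend on [I], and
   [d_c] of it is [(d/dalpha - I d/dbeta) / 2].  On the line [alpha = a],
   [Delta] is the real number [b^2 - beta^2], so that there
     [F1 / beta = sum Delta^n s_(2n+1)],
     [F0 = sum Delta^n (s_(2n) - J b s_(2n+1))],
   and [L] is [d/dDelta]; hence the odd coefficients.  For the even ones, one
   commutes [d/dalpha] with [L^k] and uses the Cauchy-Riemann equation
   [dF1/dalpha = - dF0/dbeta] to turn [d/dalpha L^k (F1 / beta)] into
   [2 L^(k+1) F0].

   That all these derivatives exist is read off the expansion of [f]: its
   coefficients grow at most geometrically, so it can be differentiated termwise, and
   the functions built from power series in [Delta], coordinates and
   [1 / beta] are closed under partial derivatives.  These functions are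
   represented by syntactic expressions with a formal derivative. *)

Require Import Defs.
From HB Require Import structures.
From mathcomp Require Import all_boot all_order all_algebra.
From mathcomp Require Import ring lra.
From mathcomp Require Import all_classical all_reals all_analysis.

Set Implicit Arguments.
Unset Strict Implicit.
Unset Printing Implicit Defensive.

Import Order.TTheory GRing.Theory Num.Theory.
Import numFieldNormedType.Exports.

Local Open Scope classical_set_scope.
Local Open Scope ring_scope.

HB.instance Definition _ (R : realType) :=
  Uniform_isComplete.Build (quat R) (@cauchy_cvg 'rV[R]_4).

(** * The modulus of quaternions and its comparison with the sup norm *)

Section QuaternionNorm.
Context {R : realType}.
Implicit Types x y : quat R.

Lemma qnorm_ge0 x : 0 <= qnorm x. Proof. exact: sqrtr_ge0. Qed.

Lemma qnorm_le x (c : R) : 0 <= c -> qnorm x ^+ 2 <= c ^+ 2 -> qnorm x <= c.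
Proof. by move=> c0; rewrite ler_sqr// nnegrE qnorm_ge0. Qed.

(** After squaring, this is Euler's four-square identity. *)
Lemma qnormM x y : qnorm (x * y) = qnorm x * qnorm y.
Proof.
apply/eqP; rewrite -(@eqrXn2 _ 2)// ?mulr_ge0 ?qnorm_ge0//.
by apply/eqP; rewrite exprMn !qnormE !qcM; ring.
Qed.

Lemma qnormD x y : qnorm (x + y) <= qnorm x + qnorm y.
Proof.
apply: qnorm_le; first by rewrite addr_ge0 ?qnorm_ge0.
suff: qc0 x * qc0 y + qc1 x * qc1 y + qc2 x * qc2 y + qc3 x * qc3 y
      <= qnorm x * qnorm y.
  by rewrite sqrrD !qnormE !qcD; lra.
(* [qconj x * y] has norm [|x||y|], and its real part is the inner product *)
have /eqP := qnormM (qconj x) y.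
rewrite -(@eqrXn2 _ 2)// ?mulr_ge0 ?qnorm_ge0// => /eqP h.
have cx : qnorm (qconj x) = qnorm x by rewrite /qnorm !qc_mk !sqrrN.
rewrite cx in h; apply: le_trans (ler_norm _) _.
rewrite -(@ler_pXn2r _ 2)// ?nnegrE ?mulr_ge0 ?qnorm_ge0// -h real_normK ?num_real//.
rewrite qnormE !qcM !qc_mk !mulNr !opprK -[leLHS]addr0 -!addrA lerD//.
by rewrite !addr_ge0 ?sqr_ge0.
Qed.

Lemma qnormZ (a : R) x : qnorm (a *: x) = `|a| * qnorm x.
Proof.
apply/eqP; rewrite -(@eqrXn2 _ 2)// ?mulr_ge0 ?qnorm_ge0//.
by apply/eqP; rewrite exprMn real_normK ?num_real// !qnormE !qcZ; ring.
Qed.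

Lemma qnorm0 : qnorm (0 : quat R) = 0.
Proof. by rewrite -(scale0r (0 : quat R)) qnormZ normr0 mul0r. Qed.

Lemma qnorm1 : qnorm (1 : quat R) = 1.
Proof. by rewrite /qnorm !qc_1 expr1n expr0n !addr0 sqrtr1. Qed.

Lemma qnormN x : qnorm (- x) = qnorm x.
Proof. by rewrite -scaleN1r qnormZ normrN1 mul1r. Qed.

Lemma qnormX x n : qnorm (x ^+ n) = qnorm x ^+ n.
Proof. by elim: n => [|n IH]; rewrite ?expr0 ?qnorm1// !exprS qnormM IH. Qed.

Lemma qnorm_sphere (I : quat R) : qsphere I -> qnorm I = 1.
Proof.
by move=> SI; rewrite -[I]scale1r qnorm_qsphere.
Qed.

Lemma qnorm_sum (u : nat -> quat R) n :
  qnorm (\sum_(0 <= i < n) u i) <= \sum_(0 <= i < n) qnorm (u i).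
Proof.
elim: n => [|n IH]; first by rewrite !big_nil qnorm0.
by rewrite !big_nat_recr//= (le_trans (qnormD _ _))// lerD2r.
Qed.

Lemma norm_le_qnorm x : `|x| <= qnorm x.
Proof.
rewrite [leLHS]mx_normrE; apply: bigmax_le => [|[i j] _ /=]; first exact: qnorm_ge0.
rewrite -(@ler_pXn2r _ 2)// ?nnegrE ?qnorm_ge0// real_normK ?num_real// qnormE.
rewrite (ord1 i); have s := @sqr_ge0 R; case: j => -[|[|[|[|//]]]] hi.
- by have := (s (qc1 x), s (qc2 x), s (qc3 x));
    rewrite /qc0 (bool_irrelevance hi isT) => -[[]]; lra.
- by have := (s (qc0 x), s (qc2 x), s (qc3 x));
    rewrite /qc1 (bool_irrelevance hi isT) => -[[]]; lra.
- by have := (s (qc0 x), s (qc1 x), s (qc3 x));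
    rewrite /qc2 (bool_irrelevance hi isT) => -[[]]; lra.
- by have := (s (qc0 x), s (qc1 x), s (qc2 x));
    rewrite /qc3 (bool_irrelevance hi isT) => -[[]]; lra.
Qed.

(** Limits live in the sup norm, estimates in the modulus. The constant 2 is the square root of the
    number of coordinates. *)
Lemma qnorm_le_norm x : qnorm x <= 2 * `|x|.
Proof.
apply: qnorm_le; first by rewrite mulr_ge0.
have h j : (x : 'rV[R]_4) ord0 j ^+ 2 <= `|x| ^+ 2.
  rewrite -[leLHS]real_normK ?num_real// ler_pXn2r// ?nnegrE//.
  by rewrite [leRHS]mx_normrE; exact: (le_bigmax _ _ (ord0, j)).
have := (h (@Ordinal 4 0 isT), h (@Ordinal 4 1 isT),
  h (@Ordinal 4 2 isT), h (@Ordinal 4 3 isT)).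
by rewrite qnormE exprMn => -[[[]]]; rewrite /qc0 /qc1 /qc2 /qc3; lra.
Qed.

End QuaternionNorm.

(** * Power series with quaternion coefficients on the right, and termwise differentiation *)

Section QuaternionPowerSeries.
Context {R : realType}.
Implicit Types (c : nat -> quat R) (w h : quat R) (rho r : R).

(** For positive [r] this says that the radius of convergence is at least [r]. Bounded terms at
    every smaller radius are easy to read off a convergent series. *)
Definition subgeometric r c : Prop := forall rho, 0 < rho < r ->
  exists M : R, forall n, rho ^+ n * qnorm (c n) <= M.

Definition qseries c w : quat R := limn (series (fun n => w ^+ n * c n)).

Definition dcoef c : nat -> quat R := fun n => n.+1%:R *: c n.+1.

(** A factor [n] is absorbed by an arbitrarily small enlargement of the radius, which keeps
    [subgeometric] stable under differentiation. *)
Lemma natr_mul_exp_le (rho sigma : R) n : 0 <= rho <= sigma ->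
  n.+1%:R * rho ^+ n * (sigma - rho) <= sigma ^+ n.+1.
Proof.
move=> /andP[r0 rs]; elim: n => [|n IH]; first by rewrite expr0 !expr1; lra.
have e : rho ^+ n.+1 <= sigma ^+ n.+1 by rewrite lerXn2r// nnegrE (le_trans r0).
have := ler_wpM2l r0 IH; have sr : 0 <= sigma - rho by rewrite subr_ge0.
have := ler_wpM2r sr e; rewrite -(natr1 n.+1) (exprS sigma n.+1) (exprS rho n).
by lra.
Qed.

Lemma midpoint (x y : R) : x < y -> exists z, x < z < y.
Proof. by move=> xy; exists ((x + y) / 2); apply/andP; split; lra. Qed.

Lemma subgeometric_natmul r c : subgeometric r c ->
  subgeometric r (fun n => n%:R *: c n).
Proof.
move=> gc rho /andP[rho0 /midpoint[sigma /andP[rs sr]]].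
have s0 : 0 < sigma by rewrite (lt_trans rho0).
have [|M hM] := gc sigma; first by rewrite s0 sr.
have d0 : 0 < sigma - rho by rewrite subr_gt0.
exists (sigma * M / (sigma - rho)) => n; rewrite qnormZ normr_nat.
rewrite ler_pdivlMr//; apply: le_trans (ler_wpM2l (ltW s0) (hM n)).
rewrite [leRHS]mulrA -exprS.
have -> : rho ^+ n * (n%:R * qnorm (c n)) * (sigma - rho) =
  n%:R * rho ^+ n * (sigma - rho) * qnorm (c n) by ring.
rewrite ler_wpM2r ?qnorm_ge0//; apply: le_trans (@natr_mul_exp_le rho sigma n _).
  by rewrite ler_wpM2r ?(ltW d0)// ler_wpM2r ?exprn_ge0 ?(ltW rho0)// ler_nat.
by rewrite !ltW.
Qed.

Lemma subgeometric_dcoef r c : subgeometric r c -> subgeometric r (dcoef c).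
Proof.
move=> /subgeometric_natmul gc rho /[dup] /andP[rho0 _] /gc[M hM].
exists (M / rho) => n; rewrite ler_pdivlMr//.
by apply: le_trans (hM n.+1); rewrite exprSr /dcoef mulrAC.
Qed.

(** Comparison with the geometric series of ratio [rho / sigma], for some [sigma] strictly between
    [rho] and [r]. *)
Lemma subgeometric_sum r c rho : subgeometric r c -> 0 < rho < r ->
  exists2 M : R, 0 <= M &
    forall n, \sum_(0 <= i < n) rho ^+ i * qnorm (c i) <= M.
Proof.
move=> gc /andP[rho0 /midpoint[sigma /andP[rs sr]]].
have s0 : 0 < sigma by rewrite (lt_trans rho0).
have [|M hM] := gc sigma; first by rewrite s0 sr.
have M0 : 0 <= M by apply: le_trans (hM 0%N); rewrite expr0 mul1r qnorm_ge0.
have q0 : 0 < rho / sigma by rewrite divr_gt0.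
have q1 : rho / sigma < 1 by rewrite ltr_pdivrMr// mul1r.
exists (M / (1 - rho / sigma)) => [|n]; first by rewrite divr_ge0// subr_ge0 ltW.
have := @geometric_le_lim R n M (rho / sigma) M0 q0.
rewrite gtr0_norm// => /(_ q1); apply: le_trans.
rewrite /series/=; apply: ler_sum => i _.
have si : 0 < sigma ^+ i by rewrite exprn_gt0.
rewrite exprMn exprVn.
have -> : rho ^+ i * qnorm (c i) =
   (sigma ^+ i * qnorm (c i)) * (rho ^+ i / sigma ^+ i).
  by field; rewrite gt_eqF.
by rewrite ler_wpM2r// divr_ge0 ?exprn_ge0 ?ltW.
Qed.

Lemma is_cvg_qseries r c w : subgeometric r c -> qnorm w < r ->
  cvgn (series (fun n => w ^+ n * c n)).
Proof.
move=> gc /midpoint[rho /andP[wr rr]].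
have rho0 : 0 < rho by rewrite (le_lt_trans (qnorm_ge0 w)).
have [|M M0 hM] := subgeometric_sum gc (rho := rho); first by rewrite rho0.
apply: normed_cvg; apply: nondecreasing_is_cvgn.
  by apply: nondecreasing_series => n _ _; exact: normr_ge0.
exists M => _ [n _ <-]; apply: le_trans (hM n); rewrite /series/=.
apply: ler_sum => i _; rewrite (le_trans (norm_le_qnorm _))// qnormM qnormX.
by rewrite ler_wpM2r ?qnorm_ge0// lerXn2r// ?nnegrE ?qnorm_ge0 ?ltW.
Qed.

Lemma qnorm_lim_le (u : nat -> quat R) (l : quat R) (B : R) :
  u @ \oo --> l -> (forall n, qnorm (u n) <= B) -> qnorm l <= 2 * B.
Proof.
move=> ul uB; apply: le_trans (qnorm_le_norm l) _; rewrite ler_pM2l//.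
have nl : `|u n| @[n --> \oo] --> `|l| by exact: cvg_norm.
rewrite -(cvg_lim _ nl)//; apply: limr_le; first by apply/cvg_ex; eexists; exact: nl.
by apply: nearW => n; rewrite (le_trans (norm_le_qnorm _)).
Qed.

(** As [w] and [h] commute, the remainders satisfy [E_(n+1) = (w + h) E_n + n h^2 w^(n-1)]. The
    factor [rho ^+ 2] on the left avoids the exponent [n - 2]. *)
Lemma exp_remainder w h rho n : GRing.comm w h -> 0 < rho ->
  qnorm w <= rho -> qnorm (w + h) <= rho ->
  rho ^+ 2 * qnorm ((w + h) ^+ n - w ^+ n - n%:R *: (h * w ^+ n.-1))
    <= n%:R ^+ 2 * rho ^+ n * qnorm h ^+ 2.
Proof.
move=> wh rho0 wr whr.
have wX k : w ^+ k * h = h * w ^+ k by apply/commr_sym/commrX/commr_sym.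
elim: n => [|n IH].
  by rewrite !expr0 subrr scale0r subr0 qnorm0 mulr0 expr0n !mul0r.
set E := (_ - _ - _) in IH.
have -> : (w + h) ^+ n.+1 - w ^+ n.+1 - n.+1%:R *: (h * w ^+ n.+1.-1) =
    (w + h) * E + n%:R *: (h ^+ 2 * w ^+ n.-1).
  have -> : (w + h) * E = (w + h) ^+ n.+1 - w ^+ n.+1 - h * w ^+ n
      - n%:R *: (w * (h * w ^+ n.-1)) - n%:R *: (h * (h * w ^+ n.-1)).
    rewrite /E !mulrBr -exprS -scalerAr !mulrDl scalerDr -exprS !opprD !addrA.
    by [].
  have -> : n%:R *: (w * (h * w ^+ n.-1)) = n%:R *: (h * w ^+ n).
    (* At [n = 0] the truncated exponent [n.-1] is harmless, as the factor [n%:R] vanishes. *)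
    case: n {IH E} => [|n]; first by rewrite !scale0r.
    by rewrite mulrA wh -mulrA -exprS.
  rewrite -natr1 scalerDl scale1r expr2 mulrA subrK opprD -!addrA.
  by congr (_ + (_ + _)); rewrite addrC.
apply: le_trans (ler_wpM2l _ (qnormD _ _)) _; first exact: exprn_ge0 (ltW _).
rewrite qnormM qnormZ normr_nat qnormM !qnormX.
have h1 : rho ^+ 2 * (qnorm (w + h) * qnorm E) <=
    rho * (n%:R ^+ 2 * rho ^+ n * qnorm h ^+ 2).
  rewrite mulrCA; apply: ler_pM => //; rewrite ?qnorm_ge0//.
  by rewrite mulr_ge0 ?qnorm_ge0 ?exprn_ge0 ?ltW.
have h2 : rho ^+ 2 * (n%:R * (qnorm h ^+ 2 * qnorm w ^+ n.-1)) <=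
    n%:R * rho ^+ n.+1 * qnorm h ^+ 2.
  case: n {IH E h1} => [|n]; first by rewrite !(mul0r, mulr0).
  have -> : rho ^+ 2 * (n.+1%:R * (qnorm h ^+ 2 * qnorm w ^+ n)) =
     n.+1%:R * rho ^+ 2 * qnorm h ^+ 2 * qnorm w ^+ n by ring.
  have -> : n.+1%:R * rho ^+ n.+2 * qnorm h ^+ 2 =
     n.+1%:R * rho ^+ 2 * qnorm h ^+ 2 * rho ^+ n by rewrite !exprS; ring.
  apply: ler_wpM2l; first by rewrite !mulr_ge0 ?exprn_ge0 ?qnorm_ge0 ?(ltW rho0).
  by rewrite lerXn2r// ?nnegrE ?qnorm_ge0 ?ltW.
(* The slack of the induction: [(n + 1)^2 - (n^2 + n) = n + 1]. *)
have h3 : 0 <= (n%:R + 1) * rho ^+ n.+1 * qnorm h ^+ 2.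
  by rewrite !mulr_ge0 ?addr_ge0 ?exprn_ge0 ?qnorm_ge0 ?(ltW rho0).
rewrite -natr1 mulrDr; move: h1 h2 h3; rewrite !(exprS rho n); lra.
Qed.

(** Sum [exp_remainder] against the coefficients; the sum of [n^2 rho^n |c_n|] is finite. *)
Lemma qseries_expansion r c rho : subgeometric r c -> 0 < rho < r ->
  exists2 K : R, 0 <= K & forall w h, GRing.comm w h ->
    qnorm w <= rho -> qnorm (w + h) <= rho ->
    qnorm (qseries c (w + h) - qseries c w - h * qseries (dcoef c) w)
      <= K * qnorm h ^+ 2.
Proof.
move=> gc /[dup] /andP[rho0 rr] rhor.
have [M M0 hM] := subgeometric_sum
  (subgeometric_natmul (subgeometric_natmul gc)) rhor.
have r20 : 0 < rho ^+ 2 by rewrite exprn_gt0.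
(* The 2 is lost in [qnorm_lim_le], and [rho ^+ 2] comes from [exp_remainder]. *)
exists (2 * (M / rho ^+ 2)) => [|w h wh wr whr].
  by rewrite mulr_ge0// divr_ge0// ltW.
have ca := is_cvg_qseries gc (le_lt_trans whr rr).
have cb := is_cvg_qseries gc (le_lt_trans wr rr).
have cd := is_cvg_qseries (subgeometric_dcoef gc) (le_lt_trans wr rr).
(* The derived series is one term shorter, since the constant term of [c] has derivative zero. *)
have cu : (fun n => series (fun n => (w + h) ^+ n * c n) n.+1
    - series (fun n => w ^+ n * c n) n.+1
    - h * series (fun n => w ^+ n * dcoef c n) n) @ \oo -->
    qseries c (w + h) - qseries c w - h * qseries (dcoef c) w.
  apply: cvgB; first apply: cvgB.
  - by rewrite (cvg_shiftS (series _)); exact: ca.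
  - by rewrite (cvg_shiftS (series _)); exact: cb.
  - exact: (continuous_cvg _ (@qmul_continuous _ h _) cd).
rewrite -mulrA; apply: (qnorm_lim_le cu) => n.
set E := fun n => (w + h) ^+ n - w ^+ n - n%:R *: (h * w ^+ n.-1).
have -> : series (fun n => (w + h) ^+ n * c n) n.+1
    - series (fun n => w ^+ n * c n) n.+1
    - h * series (fun n => w ^+ n * dcoef c n) n =
    \sum_(0 <= i < n.+1) E i * c i.
  rewrite /series/= big_distrr/= [in RHS]big_nat_recl//= {1}/E !expr0 subrr.
  rewrite scale0r subr0 mul0r add0r !big_nat_recl//= !expr0 opprD addrACA subrr.
  rewrite add0r -!sumrB; apply: eq_bigr => i _.
  by rewrite /E/= !mulrBl -scalerAl mulrA /dcoef -scalerAr.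
apply: (le_trans (qnorm_sum _ _)).
rewrite mulrAC ler_pdivlMr//.
apply: (@le_trans _ _ (\sum_(0 <= i < n.+1)
   rho ^+ i * qnorm (i%:R *: (i%:R *: c i)) * qnorm h ^+ 2)).
  rewrite big_distrl/=; apply: ler_sum => i _.
  rewrite qnormM !qnormZ !normr_nat.
  have := ler_wpM2r (qnorm_ge0 (c i)) (exp_remainder i wh rho0 wr whr).
  by rewrite -/(E i); lra.
by rewrite -big_distrl/= ler_wpM2r ?exprn_ge0 ?qnorm_ge0.
Qed.

Lemma qseries0 c : qseries c 0 = c 0%N.
Proof.
have e n : series (fun n => 0 ^+ n * c n) n.+1 = c 0%N.
  rewrite /series/= big_nat_recl//= expr0 mul1r big1 ?addr0// => i _.
  by rewrite expr0n/= mul0r.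
rewrite /qseries; apply/cvg_lim => //; rewrite -(cvg_shiftS (series _)).
by under eq_fun do rewrite e; exact: cvg_cst.
Qed.

End QuaternionPowerSeries.

(** * Directional derivatives with quadratic remainder, and their calculus rules *)

Section SecondOrderExpansion.
Context {R : realType}.
Implicit Types (f g : R * R -> quat R) (z v : R * R) (l m : quat R).

(* Derivative along [v] with a quadratic error bound: unlike the library's     *)
(* derivative, it is readily shown to be stable under quaternion products and  *)
(* composition with power series.                                              *)
Definition has_expansion f z v l : Prop := exists2 K : R, 0 <= K &
  \forall h \near (0 : R), qnorm (f (h *: v + z) - f z - h *: l) <= K * h ^+ 2.

Lemma near0_le (e : R) : 0 < e -> \forall h \near (0 : R), `|h| <= e.
Proof. exact: (@nbhs0_le R R). Qed.

Lemma has_expansion_cvg f z v l : has_expansion f z v l ->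
  h^-1 *: (f (h *: v + z) - f z) @[h --> (0 : R)^'] --> l.
Proof.
move=> [K K0 fl]; apply/cvgrPdist_le => e e0.
have eK : 0 < e / (K + 1) by rewrite divr_gt0// ltr_wpDl.
near=> h; have h0 : h != 0 by near: h; exact: nbhs_dnbhs_neq.
rewrite distrC; apply: le_trans (norm_le_qnorm _) _.
rewrite -[X in _ - X]scale1r -(mulVf h0) -scalerA -scalerBr qnormZ normfV.
rewrite mulrC ler_pdivrMr ?normr_gt0//.
have : qnorm (f (h *: v + z) - f z - h *: l) <= K * h ^+ 2.
  by near: h; exact: nbhs_dnbhs.
move/le_trans; apply; rewrite -(real_normK (num_real h)) expr2 mulrA.
rewrite ler_wpM2r//; have : `|h| <= e / (K + 1).
  by near: h; apply: nbhs_dnbhs; exact: near0_le.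
rewrite ler_pdivlMr ?ltr_wpDl//; have := normr_ge0 h; lra.
Unshelve. all: by end_near. Qed.

Lemma has_expansion_derive f z v l : has_expansion f z v l -> 'D_v f z = l.
Proof. by move=> /has_expansion_cvg /cvg_lim; exact. Qed.

(** Agreement is asked only along the line through [z] in direction [v]; this serves on the line
    [alpha = Re q], where closed formulas are available. *)
Lemma has_expansion_unique f g z v l m :
  has_expansion f z v l -> has_expansion g z v m ->
  (\forall h \near (0 : R), f (h *: v + z) = g (h *: v + z)) -> l = m.
Proof.
move=> /has_expansion_cvg fl /has_expansion_cvg gm fg.
have fgz : f z = g z by have := nbhs_singleton fg; rewrite scale0r add0r.
apply: (cvg_unique (@norm_hausdorff _ _) fl); apply: cvg_trans gm; apply: near_eq_cvg.
by apply: nbhs_dnbhs; apply: filterS fg => h e /=; rewrite fgz e.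
Qed.

Lemma has_expansion_cst (x : quat R) z v : has_expansion (fun=> x) z v 0.
Proof.
by exists 0 => //; near=> h; rewrite subrr scaler0 subr0 qnorm0 mul0r.
Unshelve. all: by end_near. Qed.

Lemma has_expansionD f g z v l m : has_expansion f z v l ->
  has_expansion g z v m -> has_expansion (fun w => f w + g w) z v (l + m).
Proof.
move=> [K K0 fl] [M M0 gm]; exists (K + M); first exact: addr_ge0.
near=> h; rewrite mulrDl scalerDr !opprD.
rewrite [f _ + g _ + _]addrACA [_ + (- (h *: l) - _)]addrACA.
apply: le_trans (qnormD _ _) _; apply: lerD; by near: h.
Unshelve. all: by end_near. Qed.

Lemma has_expansionM f g z v l m : has_expansion f z v l ->
  has_expansion g z v m ->
  has_expansion (fun w => f w * g w) z v (l * g z + f z * m).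
Proof.
move=> [K K0 fl] [M M0 gm].
exists ((qnorm (f z) + qnorm l + K) * M + K * (qnorm (g z) + qnorm m)
   + qnorm l * qnorm m).
  by rewrite !(addr_ge0, mulr_ge0, qnorm_ge0).
near=> h; have h1 : `|h| <= 1 by near: h; exact: near0_le.
have h2 : h ^+ 2 <= 1 by rewrite -(real_normK (num_real h)) exprn_ile1.
set x := f (_ + _); set y := g (_ + _).
have hx : qnorm (x - f z - h *: l) <= K * h ^+ 2 by rewrite /x; near: h.
have hy : qnorm (y - g z - h *: m) <= M * h ^+ 2 by rewrite /y; near: h.
(* Grouped so that each of the three summands contains a factor of order [h ^+ 2]; they match the
   three terms of the constant above. *)
have -> : x * y - f z * g z - h *: (l * g z + f z * m) =
    (f z + h *: l + (x - f z - h *: l)) * (y - g z - h *: m) +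
    ((x - f z - h *: l) * (g z + h *: m) + h ^+ 2 *: (l * m)).
  by apply: qP; rewrite !(qcD, qcN, qcZ, qcM); ring.
have hZ (u w : quat R) : qnorm (u + h *: w) <= qnorm u + qnorm w.
  apply: le_trans (qnormD _ _) _; rewrite lerD2l qnormZ.
  by rewrite -[leRHS]mul1r ler_wpM2r ?qnorm_ge0.
rewrite -[X in _ <= X * _]addrA [leRHS]mulrDl [X in _ <= _ + X]mulrDl.
have sq : 0 <= h ^+ 2 by exact: sqr_ge0.
apply: le_trans (qnormD _ _) (lerD _ _).
  rewrite qnormM -mulrA; apply: ler_pM; rewrite ?qnorm_ge0//.
  apply: le_trans (qnormD _ _) (lerD (hZ _ _) _).
  by apply: le_trans hx _; rewrite -[leRHS]mulr1 ler_wpM2l.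
apply: le_trans (qnormD _ _) (lerD _ _).
  by rewrite qnormM mulrAC; apply: ler_pM; rewrite ?qnorm_ge0.
by rewrite qnormZ qnormM ger0_norm// mulrC.
Unshelve. all: by end_near. Qed.

Lemma has_expansion_qpt I z v : has_expansion (fun w => qpt w I) z v (qpt v I).
Proof.
exists 0 => //; near=> h; rewrite mul0r.
rewrite (_ : _ - _ = 0) ?qnorm0//.
by apply: qP; rewrite /qpt !(qcD, qcN, qcZ, qc_0, qc_1)/= /GRing.scale/=; ring.
Unshelve. all: by end_near. Qed.

Lemma has_expansion_inv2 z v : 0 < z.2 ->
  has_expansion (fun w => (w.2^-1)%:A) z v (- (v.2 * z.2^-1 * z.2^-1))%:A.
Proof.
(* With [beta = z.2], the error is exactly [h^2 v.2^2 / (beta^2 (beta + h v.2))], and [beta + h v.2]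
   is at least [beta / 2] for small [h]. *)
move=> z0; exists (2 * v.2 ^+ 2 / z.2 ^+ 3).
  by apply: divr_ge0; [rewrite mulr_ge0 ?sqr_ge0|exact/exprn_ge0/ltW].
near=> h.
have hv : `|h * v.2| <= z.2 / 2.
  have : `|h| <= z.2 / 2 / (`|v.2| + 1).
    by near: h; apply: near0_le; rewrite !divr_gt0// ltr_wpDl.
  rewrite ler_pdivlMr ?ltr_wpDl// normrM; have := normr_ge0 h; lra.
have hz : z.2 / 2 <= h * v.2 + z.2 by move: hv; rewrite ler_norml => /andP[]; lra.
have p0 : 0 < h * v.2 + z.2 by apply: lt_le_trans hz; rewrite divr_gt0.
rewrite -!scaleNr scalerA -!scalerDl qnormZ qnorm1 mulr1/=.
set t := (X in `|X|); have -> : t =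
   h ^+ 2 * v.2 ^+ 2 / z.2 ^+ 2 / (h * v.2 + z.2).
  by rewrite /t /GRing.scale/=; field; rewrite !gt_eqF.
have q0 : 0 <= h ^+ 2 * v.2 ^+ 2 / z.2 ^+ 2.
  by apply: divr_ge0; [apply: mulr_ge0|]; exact: sqr_ge0.
rewrite ger0_norm; last by apply: divr_ge0 => //; exact: ltW.
rewrite ler_pdivrMr//.
have -> : 2 * v.2 ^+ 2 / z.2 ^+ 3 * h ^+ 2 * (h * v.2 + z.2) =
   h ^+ 2 * v.2 ^+ 2 / z.2 ^+ 2 * ((h * v.2 + z.2) * 2 / z.2).
  by field; rewrite gt_eqF.
rewrite -[leLHS]mulr1 ler_wpM2l//.
by rewrite ler_pdivlMr//; lra.
Unshelve. all: by end_near. Qed.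

(** Both factors lie in the real span of 1 and [I], which is commutative. Such commutations make the
    power series behave as in one complex variable. *)
Lemma qpt_comm z v (I : quat R) : qpt z I * qpt v I = qpt v I * qpt z I.
Proof. by apply: qP; rewrite /qpt !(qcM, qcD, qcZ, qc_1); ring. Qed.

Lemma qpt_centered_comm z v (I : quat R) (a : R) :
  (qpt z I - a%:A) * qpt v I = qpt v I * (qpt z I - a%:A).
Proof. by apply: qP; rewrite /qpt !(qcM, qcD, qcN, qcZ, qc_1); ring. Qed.

Lemma DeltaE (q x : quat R) :
  Delta q x = (x - (qRe q)%:A) ^+ 2 + (qnorm q ^+ 2 - qRe q ^+ 2)%:A.
Proof.
by rewrite /Delta !expr2; apply: qP; rewrite /qRe !(qcM, qcD, qcN, qcZ, qc_1); ring.
Qed.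

Lemma Delta_shift (q I : quat R) z v (h : R) :
  Delta q (qpt (h *: v + z) I) = Delta q (qpt z I) +
    (h *: (2 *: ((qpt z I - (qRe q)%:A) * qpt v I)) + h ^+ 2 *: qpt v I ^+ 2).
Proof.
have -> : qpt (h *: v + z) I = qpt z I + h *: qpt v I.
  by rewrite /qpt/= !scalerDl scalerDr !scalerA addrACA addrC.
rewrite !DeltaE [X in X ^+ 2]addrAC.
set x := qpt z I - _; set y := qpt v I.
have xy : y * x = x * y by rewrite /x /y qpt_centered_comm.
clearbody x y.
have -> : (x + h *: y) ^+ 2 = x ^+ 2 + (h *: (2 *: (x * y)) + h ^+ 2 *: y ^+ 2).
  rewrite !expr2 mulrDl !mulrDr -!scalerAl -!scalerAr xy scalerA -!addrA.
  by rewrite scaler_nat mulr2n scalerDr !addrA.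
by rewrite addrAC.
Qed.

(** Chain rule: by [Delta_shift] the increment [H] of [Delta] is exactly quadratic in [h], and it
    commutes with [w], so [qseries_expansion] applies. *)
Lemma has_expansion_qseries (q I : quat R) r c z v :
  subgeometric r c -> qnorm (Delta q (qpt z I)) < r ->
  has_expansion (fun w => qseries c (Delta q (qpt w I))) z v
    ((2 *: qpt v I) * ((qpt z I - (qRe q)%:A) *
       qseries (dcoef c) (Delta q (qpt z I)))).
Proof.
set w := Delta q (qpt z I) => gc /midpoint[rho /andP[wr rr]].
have rho0 : 0 < rho by rewrite (le_lt_trans (qnorm_ge0 w)).
have [|K K0 hK] := qseries_expansion gc (rho := rho); first by rewrite rho0.
set x := 2 *: ((qpt z I - (qRe q)%:A) * qpt v I); set y := qpt v I ^+ 2.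
set S' := qseries (dcoef c) w.
(* The first term bounds the remainder of the power series, as [|H| <= |h| (|x| + |y|)] for
   [|h| <= 1]; the second is the part of [H * S'] of order two. *)
exists (K * (qnorm x + qnorm y) ^+ 2 + qnorm (y * S')).
  by rewrite addr_ge0 ?qnorm_ge0// mulr_ge0 ?sqr_ge0.
have C0 : 0 <= qnorm x + qnorm y by rewrite addr_ge0 ?qnorm_ge0.
near=> h; have h1 : `|h| <= 1 by near: h; exact: near0_le.
rewrite Delta_shift -/w -/x -/y; set H := h *: x + h ^+ 2 *: y.
have Hh : qnorm H <= `|h| * (qnorm x + qnorm y).
  apply: le_trans (qnormD _ _) _; rewrite (qnormZ h) (qnormZ (_ ^+ 2)) mulrDr lerD2l.
  by rewrite normrX expr2 -mulrA ler_wpM2l// -[leRHS]mul1r ler_wpM2r ?qnorm_ge0.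
have wHr : qnorm (w + H) <= rho.
  apply: le_trans (qnormD _ _) _; rewrite -lerBrDl (le_trans Hh)//.
  have : `|h| <= (rho - qnorm w) / (qnorm x + qnorm y + 1).
    by near: h; apply: near0_le; rewrite divr_gt0 ?subr_gt0// ltr_wpDl.
  by rewrite ler_pdivlMr ?ltr_wpDl//; have := normr_ge0 h; lra.
have wH : GRing.comm w H.
  have commZ (u t : quat R) (k : R) : GRing.comm u t -> GRing.comm u (k *: t).
    by rewrite /GRing.comm -scalerAr -scalerAl => ->.
  have zv : GRing.comm (qpt z I - (qRe q)%:A) (qpt v I).
    exact: qpt_centered_comm.
  (* [w] is a polynomial with real coefficients in [qpt z I - Re q]. *)
  have wC t : GRing.comm t (qpt z I - (qRe q)%:A) -> GRing.comm w t.
    move=> tz; apply: commr_sym; rewrite /w DeltaE; apply: commrD.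
      exact: commrX.
    by apply: commZ; exact: commr1.
  have wz := wC _ (commr_refl _); have wv := wC _ (commr_sym zv).
  apply: commrD; apply/commZ; last exact: commrX.
  by apply/commZ; exact: commrM.
have -> : (2 *: qpt v I) * ((qpt z I - (qRe q)%:A) * S') = x * S'.
  by rewrite mulrA /x -!scalerAl qpt_centered_comm.
have -> : qseries c (w + H) - qseries c w - h *: (x * S') =
   (qseries c (w + H) - qseries c w - H * S') + h ^+ 2 *: (y * S').
  have -> : H * S' = h *: (x * S') + h ^+ 2 *: (y * S').
    by rewrite /H mulrDl; congr (_ + _); rewrite -scalerAl.
  by rewrite [in RHS]opprD [X in _ = X + _]addrA subrK.
apply: le_trans (qnormD _ _) _; rewrite [leRHS]mulrDl; apply: lerD; last first.
  by rewrite qnormZ ger0_norm ?sqr_ge0// mulrC.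
apply: le_trans (hK _ _ wH (ltW wr) wHr) _; rewrite -mulrA ler_wpM2l//.
rewrite -exprMn -(real_normK (num_real (_ * h))) lerXn2r ?nnegrE ?qnorm_ge0//.
by rewrite normrM (ger0_norm C0) mulrC.
Unshelve. all: by end_near. Qed.

End SecondOrderExpansion.

(** * A class of expressions closed under formal differentiation *)

Section SmoothExpressions.
Context {R : realType}.
Implicit Types (q I : quat R) (z v : R * R) (r : R) (W : set (R * R)).

(* [Delta q] maps [qpt z I] to [qpt (Delta_coord q z) I], whatever the imaginary *)
(* unit [I].                                                                   *)
Definition Delta_coord q z : R * R :=
  ((z.1 - qRe q) ^+ 2 - z.2 ^+ 2 + (qnorm q ^+ 2 - qRe q ^+ 2),
   2 * (z.1 - qRe q) * z.2).

Lemma Delta_qpt q z I : qsphere I -> Delta q (qpt z I) = qpt (Delta_coord q z) I.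
Proof.
move=> /qsphere_coord[I0 I1]; rewrite DeltaE /qpt /Delta_coord/= expr2.
have -> : z.2 ^+ 2 = z.2 ^+ 2 * (qc1 I ^+ 2 + qc2 I ^+ 2 + qc3 I ^+ 2).
  by rewrite I1 mulr1.
by apply: qP; rewrite !(qcM, qcD, qcN, qcZ, qc_1) I0; ring.
Qed.

Lemma qnorm_qpt z I : qsphere I -> qnorm (qpt z I) ^+ 2 = z.1 ^+ 2 + z.2 ^+ 2.
Proof.
move=> /qsphere_coord[I0 I1]; rewrite qnormE /qpt !(qcD, qcZ, qc_1) I0.
have -> : z.2 ^+ 2 = z.2 ^+ 2 * (qc1 I ^+ 2 + qc2 I ^+ 2 + qc3 I ^+ 2).
  by rewrite I1 mulr1.
ring.
Qed.

(** The upper half-plane trace of the region [|Delta| < r], the same for every imaginary unit.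
    [Uball q r] corresponds to the radius [r ^+ 2]. *)
Definition Delta_disc q r : set (R * R) := [set z | 0 < z.2 /\
  (Delta_coord q z).1 ^+ 2 + (Delta_coord q z).2 ^+ 2 < r ^+ 2].

Lemma Delta_disc_lt q r z I : 0 < r -> qsphere I -> Delta_disc q r z ->
  qnorm (Delta q (qpt z I)) < r.
Proof.
move=> r0 SI [_]; rewrite -(@qnorm_qpt _ I)// -Delta_qpt//.
by rewrite ltr_pXn2r// ?nnegrE ?qnorm_ge0// ltW.
Qed.

Lemma open_Delta_disc q r : open (Delta_disc q r).
Proof.
pose u (z : R * R) := (Delta_coord q z).1 ^+ 2 + (Delta_coord q z).2 ^+ 2.
have c1 : continuous (fun z : R * R => z.1) by move=> z; exact: cvg_fst.
have c2 : continuous (fun z : R * R => z.2) by move=> z; exact: cvg_snd.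
have cu : continuous u.
  move=> z; have ca : (w.1 - qRe q) @[w --> z] --> z.1 - qRe q.
    by apply: cvgB; [exact: c1|exact: cvg_cst].
  have cX (g : R * R -> R) (l : R) : g w @[w --> z] --> l ->
      g w ^+ 2 @[w --> z] --> l ^+ 2 by move=> gl; exact: (cvgM gl gl).
  rewrite /u /Delta_coord/=; apply: cvgD; apply: (cX).
    apply: cvgD; last exact: cvg_cst.
    by apply: cvgB; apply: (cX) => //; exact: c2.
  by apply: cvgM; [apply: cvgM => //; exact: cvg_cst|exact: c2].
have -> : Delta_disc q r = (fun z : R * R => z.2) @^-1` [set x | 0 < x] `&`
    u @^-1` [set x | x < r ^+ 2] by [].
apply: openI.
  by move/continuousP: c2; apply; exact: open_gt.
by move/continuousP: cu; apply; exact: open_lt.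
Qed.

(* [Evar I] is [alpha + I beta - Re q], [Eser I c] the power series with         *)
(* coefficients [c] in [Delta q (alpha + I beta)], and [Einv] is [1 / beta].    *)
Inductive expr :=
| Ecst of quat R
| Evar of quat R
| Eser of quat R & (nat -> quat R)
| Einv
| Eadd of expr & expr
| Emul of expr & expr.

Fixpoint eval q (e : expr) z : quat R := match e with
| Ecst x => x
| Evar J => qpt z J - (qRe q)%:A
| Eser J c => qseries c (Delta q (qpt z J))
| Einv => (z.2^-1)%:A
| Eadd e1 e2 => eval q e1 z + eval q e2 z
| Emul e1 e2 => eval q e1 z * eval q e2 z
end.

Fixpoint wf r (e : expr) : Prop := match e with
| Eser J c => qsphere J /\ subgeometric r c
| Eadd e1 e2 | Emul e1 e2 => wf r e1 /\ wf r e2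
| _ => True
end.

Fixpoint diff v (e : expr) : expr := match e with
| Ecst _ => Ecst 0
| Evar J => Ecst (qpt v J)
| Eser J c => Emul (Ecst (2 *: qpt v J)) (Emul (Evar J) (Eser J (dcoef c)))
| Einv => Emul (Ecst (- v.2)%:A) (Emul Einv Einv)
| Eadd e1 e2 => Eadd (diff v e1) (diff v e2)
| Emul e1 e2 => Eadd (Emul (diff v e1) e2) (Emul e1 (diff v e2))
end.

Lemma wf_diff r v e : wf r e -> wf r (diff v e).
Proof.
elim: e => //= [I c [SI gc]|e1 IH1 e2 IH2 [w1 w2]|e1 IH1 e2 IH2 [w1 w2]].
- by do !split; rewrite //; exact: subgeometric_dcoef.
- by split; [exact: IH1|exact: IH2].
- by do !split; rewrite //; [exact: IH1|exact: IH2].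
Qed.

Lemma has_expansion_eval q r v e z : 0 < r -> wf r e -> Delta_disc q r z ->
  has_expansion (eval q e) z v (eval q (diff v e) z).
Proof.
move=> r0 we Wz.
elim: e we => /= [x _|I _|I c [SI gc]|_|e1 IH1 e2 IH2 [w1 w2]|e1 IH1 e2 IH2 [w1 w2]].
- exact: has_expansion_cst.
- rewrite -[qpt v I]addr0; apply: has_expansionD; first exact: has_expansion_qpt.
  exact: has_expansion_cst.
- by apply: has_expansion_qseries => //; [exact: gc|exact: Delta_disc_lt].
- have -> : (- v.2)%:A * ((z.2^-1)%:A * (z.2^-1)%:A) =
      (- (v.2 * z.2^-1 * z.2^-1))%:A :> quat R.
    by rewrite !mulr_algl !scalerA; congr (_ *: _); ring.
  by apply: has_expansion_inv2; case: Wz.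
- by apply: has_expansionD; [exact: IH1|exact: IH2].
- by apply: has_expansionM; [exact: IH1|exact: IH2].
Qed.

Lemma derive_eval q r v e z : 0 < r -> wf r e -> Delta_disc q r z ->
  'D_v (eval q e) z = eval q (diff v e) z.
Proof. by move=> r0 we Wz; apply: has_expansion_derive; exact: has_expansion_eval we Wz. Qed.

(** A purely algebraic check by induction on [e]; the power series case rests on commutativity
    within the slice of [I]. *)
Lemma diff_comm q u v e z :
  eval q (diff u (diff v e)) z = eval q (diff v (diff u e)) z.
Proof.
elim: e => [x|I|I c||e1 IH1 e2 IH2|e1 IH1 e2 IH2] //=.
- rewrite !mul0r !add0r; set Z := qpt z I - _.
  have uv : qpt u I * qpt v I = qpt v I * qpt u I by exact: qpt_comm.
  have Zu : Z * qpt u I = qpt u I * Z by exact: qpt_centered_comm.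
  have Zv : Z * qpt v I = qpt v I * Z by exact: qpt_centered_comm.
  clearbody Z; rewrite !mulrDr -!scalerAl -!scalerAr !mulrA uv; congr (_ + _).
  congr (_ *: _); rewrite -?scalerAl -?scalerAr; congr (_ *: _).
  by rewrite -[_ * Z * qpt u I]mulrA Zu -[_ * Z * qpt v I]mulrA Zv !mulrA uv.
- rewrite !mul0r !add0r -!scalerAl !mul1r -!scalerAl -!scalerAr !mul1r !scalerA.
  by rewrite !scalerDr !scalerA; congr (_ *: _ + _ *: _); ring.
- by rewrite IH1 IH2.
- by rewrite IH1 IH2 addrACA.
Qed.

(* The derivative with respect to [u = - beta ^ 2] at fixed [alpha], that is,   *)
(* [- (2 beta)^-1 d/dbeta].                                                    *)
Definition diffu e : expr :=
  Emul (Ecst (- 2^-1)%:A) (Emul Einv (diff (0, 1) e)).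

Lemma diffuE q e z :
  eval q (diffu e) z = (- (2^-1 * z.2^-1)) *: eval q (diff (0, 1) e) z.
Proof. by rewrite /= !mulr_algl scalerA mulNr. Qed.

Lemma wf_diffu r e : wf r e -> wf r (diffu e).
Proof. by move=> we; do !split; exact: wf_diff. Qed.

Lemma wf_iter_diffu r e k : wf r e -> wf r (iter k diffu e).
Proof. by move=> we; elim: k => //= k IH; exact: wf_diffu. Qed.

(** [diff] acts on syntax, but on an open set it computes the true derivative, so equal values have
    equal formal derivatives. *)
Lemma eval_diff_eq q r W v e1 e2 : 0 < r -> open W -> W `<=` Delta_disc q r ->
  wf r e1 -> wf r e2 -> {in W, eval q e1 =1 eval q e2} ->
  {in W, eval q (diff v e1) =1 eval q (diff v e2)}.
Proof.
move=> r0 oW Wr w1 w2 e12 z; rewrite inE => Wz.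
rewrite -!(derive_eval _ r0)//; [|exact: Wr..].
apply: near_eq_derive; near=> y; apply: e12; rewrite inE.
by near: y; exact: open_nbhs_nbhs.
Unshelve. all: by end_near. Qed.

Lemma eval_diffu_eq q r W e1 e2 : 0 < r -> open W -> W `<=` Delta_disc q r ->
  wf r e1 -> wf r e2 -> {in W, eval q e1 =1 eval q e2} ->
  {in W, eval q (diffu e1) =1 eval q (diffu e2)}.
Proof.
move=> r0 oW Wr w1 w2 e12 z Wz.
by rewrite !diffuE (eval_diff_eq (0, 1) r0 oW Wr w1 w2 e12 Wz).
Qed.

Lemma eval_iter_diffu_eq q r W e1 e2 k : 0 < r -> open W ->
  W `<=` Delta_disc q r -> wf r e1 -> wf r e2 ->
  {in W, eval q e1 =1 eval q e2} ->
  {in W, eval q (iter k diffu e1) =1 eval q (iter k diffu e2)}.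
Proof.
move=> r0 oW Wr w1 w2 e12; elim: k => //= k IH.
by apply: (eval_diffu_eq r0 oW Wr) IH; exact: wf_iter_diffu.
Qed.

(** Mixed partial derivatives agree, and the factor [1 / beta] in [diffu] does not depend on
    [alpha]. *)
Lemma diff_iter_diffu q r W e k : 0 < r -> open W -> W `<=` Delta_disc q r ->
  wf r e ->
  {in W, eval q (diff (1, 0) (iter k diffu e)) =1
         eval q (iter k diffu (diff (1, 0) e))}.
Proof.
move=> r0 oW Wr we; elim: k => // k IH z Wz; rewrite !iterS.
have wk := wf_iter_diffu k we.
have w1 := wf_diff (1, 0) wk; have w2 := wf_iter_diffu k (wf_diff (1, 0) we).
rewrite -(eval_diffu_eq r0 oW Wr w1 w2 IH Wz) !diffuE diff_comm /=.
by rewrite oppr0 !scale0r !mul0r !add0r !mulr_algl scalerA mulNr.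
Qed.

(** On this line [Delta] is a constant minus [beta ^ 2], so [diffu] is differentiation in [Delta].
    As [d/dbeta] is tangent to the line, the values of [e] there suffice. *)
Lemma eval_diffu_line q r W e J c : 0 < r -> open W -> W `<=` Delta_disc q r ->
  wf r e -> qsphere J -> subgeometric r c ->
  (forall z, W z -> z.1 = qRe q -> eval q e z = eval q (Eser J c) z) ->
  forall z, W z -> z.1 = qRe q ->
    eval q (diffu e) z = eval q (Eser J (dcoef c)) z.
Proof.
move=> r0 oW Wr we SJ gc ec z Wz za.
have wS : wf r (Eser J c) by [].
rewrite diffuE; have -> : eval q (diff (0, 1) e) z = eval q (diff (0, 1) (Eser J c)) z.
  apply: (has_expansion_unique (has_expansion_eval _ r0 we (Wr _ Wz))
                               (has_expansion_eval _ r0 wS (Wr _ Wz))).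
  have : \forall h \near (0 : R), W (h *: ((0, 1) : R * R) + z).
    have ch : (h *: ((0, 1) : R * R) + z) @[h --> (0 : R)] --> z.
      rewrite -[X in _ --> X]add0r -(scale0r ((0, 1) : R * R)).
      by apply: cvgD; [apply: cvgZl; exact: cvg_id|exact: cvg_cst].
    by apply: ch; exact: open_nbhs_nbhs.
  by apply: filterS => h Wh; apply: ec => //=; rewrite scaler0 add0r.
have [z0 _] := Wr _ Wz.
rewrite [eval q (diff _ _) z]/=; set S := qseries _ _.
(* The derivative of [Delta] is [2 J (beta J) = - 2 beta], which cancels the factor of [diffu]. *)
have -> : qpt z J - (qRe q)%:A = z.2 *: J by rewrite /qpt za addrC addKr.
have -> : qpt (0, 1) J = J by rewrite /qpt scale0r add0r scale1r.
rewrite mulrA -!scalerAl -scalerAr -expr2 SJ !scalerA -scalerAl mulN1r.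
rewrite scalerA scalerN -scaleNr -[RHS]scale1r; congr (_ *: _).
by field; rewrite gt_eqF.
Qed.

Lemma fact_iter_dcoef (c : nat -> quat R) k n :
  n`!%:R *: iter k dcoef c n = (n + k)`!%:R *: c (n + k)%N.
Proof.
elim: k n => [|k IH] n; first by rewrite addn0.
by rewrite iterS /dcoef scalerA mulrC -natrM -factS IH addSnnS.
Qed.

(** Where [Delta] vanishes, only the constant term of the [k]-th derived series survives. *)
Lemma eval_iter_diffu_line q r W e J c k : 0 < r -> open W ->
  W `<=` Delta_disc q r -> wf r e -> qsphere J -> subgeometric r c ->
  (forall z, W z -> z.1 = qRe q -> eval q e z = eval q (Eser J c) z) ->
  forall z, W z -> z.1 = qRe q -> Delta q (qpt z J) = 0 ->
    eval q (iter k diffu e) z = k`!%:R *: c k.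
Proof.
move=> r0 oW Wr we SJ gc ec z Wz za D0.
have gk j : subgeometric r (iter j dcoef c).
  by elim: j => //= j; exact: subgeometric_dcoef.
have lk j w : W w -> w.1 = qRe q ->
    eval q (iter j diffu e) w = eval q (Eser J (iter j dcoef c)) w.
  elim: j w => //= j IH; apply: (eval_diffu_line r0 oW Wr) IH => //.
  exact: wf_iter_diffu.
rewrite lk//= D0 qseries0.
by have := fact_iter_dcoef c k 0; rewrite fact0 scale1r add0n.
Qed.

End SmoothExpressions.

(** * The spherical expansion as two power series, and pointwise forms of the operators *)

Section SphericalExpansion.
Context {R : realType}.
Implicit Types (q I x : quat R) (z : R * R) (s : nat -> quat R).

Lemma qsphereN I : qsphere I -> qsphere (- I).
Proof. by rewrite /qsphere/= sqrrN. Qed.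

Lemma qptN z I : qpt z (- I) = qpt (cconj z) I.
Proof. by rewrite /qpt /cconj/= scalerN scaleNr. Qed.

Lemma mul_sphereK I y : qsphere I -> I * (I * y) = - y.
Proof. by rewrite /qsphere/= mulrA -expr2 => ->; rewrite mulN1r. Qed.

Lemma qRe_addIm q : (qRe q)%:A + qIm q = q.
Proof.
by apply: qP; rewrite /qIm /qRe !(qcD, qcZ, qcN, qc_1, qc_mk); field.
Qed.

Lemma qnorm_qIm q : qnorm (qIm q) ^+ 2 = qnorm q ^+ 2 - qRe q ^+ 2.
Proof.
by rewrite !qnormE /qIm /qRe !(qcD, qcZ, qcN, qc_mk); field.
Qed.

Lemma half_double x : 2^-1 *: (x + x) = x.
Proof. by rewrite -{1 2}[x]scale1r -!scalerDl scalerA mulVf ?scale1r ?pnatr_eq0. Qed.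

Lemma qIm_dir q : qIm q = (qcoord q).2 *: qdir q.
Proof.
rewrite -{1}(qpt_qdir q) qIm_qpt//; exact: qdir_sphere.
Qed.

Lemma Delta_line q z I : qsphere I -> z.1 = qRe q ->
  Delta q (qpt z I) = (qnorm (qIm q) ^+ 2 - z.2 ^+ 2)%:A.
Proof.
move=> SI za; rewrite Delta_qpt// /Delta_coord /qpt/= za subrr mulr0 mul0r.
by rewrite scale0r addr0 qnorm_qIm expr0n/= sub0r addrC.
Qed.

(* The expansion regrouped as                                                  *)
(* [sum Delta ^ n c_n + (x - Re q) sum Delta ^ n d_n].                         *)
Definition ccoef q s : nat -> quat R := fun n => s n.*2 - qIm q * s n.*2.+1.
Definition odd_coef s : nat -> quat R := fun n => s n.*2.+1.

Lemma ccoefE q s x n : s n.*2 + (x - q) * s n.*2.+1 =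
  ccoef q s n + (x - (qRe q)%:A) * odd_coef s n.
Proof.
rewrite -{1}(qRe_addIm q) opprD addrA mulrBl /ccoef /odd_coef.
by rewrite addrA addrAC.
Qed.

Lemma spherical_series_terms_bounded q s x :
  cvgn (series (fun n => Delta q x ^+ n * (s n.*2 + (x - q) * s n.*2.+1))) ->
  exists M : R, forall n,
    qnorm (Delta q x ^+ n * (s n.*2 + (x - q) * s n.*2.+1)) <= M.
Proof.
move=> /cvg_series_cvg_0 c0.
have /cvg_seq_bounded [M [_ hM]] : cvgn
    (fun n => Delta q x ^+ n * (s n.*2 + (x - q) * s n.*2.+1)).
  by apply/cvg_ex; eexists; exact: c0.
exists (2 * (M + 1)) => n; apply: le_trans (qnorm_le_norm _) _.
by rewrite ler_pM2l//; apply: hM => //; rewrite ltrDl.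
Qed.

(** Convergence at one point only bounds a combination of the two coefficients; half the sum and
    half the difference over two conjugate points separate them. *)
Lemma subgeometric_coefs (f : quat R -> quat R) q s r : 0 < r ->
  (forall x, Uball q r x ->
      series (fun n => Delta q x ^+ n * (s n.*2 + (x - q) * s n.*2.+1)) @ \oo
        --> f x) ->
  subgeometric (r ^+ 2) (ccoef q s) /\ subgeometric (r ^+ 2) (odd_coef s).
Proof.
move=> r0 fs.
suff h rho : 0 < rho < r ^+ 2 -> exists2 M : R,
    (forall n, rho ^+ n * qnorm (ccoef q s n) <= M) &
    (forall n, rho ^+ n * qnorm (odd_coef s n) <= M).
  by split=> rho /h[M hc hd]; exists M.
(* Chosen so that [Delta] equals [- rho] at [Re q + t I]. With a negative value the square root
   exists for every [rho]. *)
move=> /andP[rho0 rr]; set t := Num.sqrt (qnorm (qIm q) ^+ 2 + rho).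
have t2 : t ^+ 2 = qnorm (qIm q) ^+ 2 + rho.
  by rewrite sqr_sqrtr// addr_ge0 ?sqr_ge0 ?ltW.
have t0 : 0 < t by rewrite sqrtr_gt0 ltr_wpDl ?sqr_ge0.
(* at the two conjugate points with [Delta = - rho] over [alpha = Re q] *)
have key I : qsphere I -> exists M : R, forall n,
    rho ^+ n * qnorm (ccoef q s n + (t *: I) * odd_coef s n) <= M.
  move=> SI; pose x := qpt (qRe q, t) I.
  have Dx : Delta q x = (- rho)%:A.
    by rewrite /x Delta_line//= t2 opprD addNKr.
  have /fs xs : Uball q r x.
    by rewrite /Uball/= Dx qnormZ qnorm1 mulr1 normrN gtr0_norm.
  have /spherical_series_terms_bounded[M hM] : cvgn (series
      (fun n => Delta q x ^+ n * (s n.*2 + (x - q) * s n.*2.+1))).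
    by apply/cvg_ex; eexists; exact: xs.
  exists M => n; move: (hM n); rewrite qnormM qnormX Dx qnormZ qnorm1 mulr1.
  rewrite normrN gtr0_norm// ccoefE (_ : x - (qRe q)%:A = t *: I)//.
  by rewrite /x /qpt/= addrC addKr.
have SJ := qdir_sphere q.
have [M hM] := key _ SJ; have [N hN] := key _ (qsphereN SJ).
have cMN n : rho ^+ n * qnorm (ccoef q s n) <= (M + N) / 2.
  have -> : ccoef q s n = 2^-1 *: ((ccoef q s n + (t *: qdir q) * odd_coef s n) +
     (ccoef q s n + (t *: - qdir q) * odd_coef s n)).
    by rewrite scalerN mulNr addrACA subrr addr0 half_double.
  rewrite qnormZ gtr0_norm ?invr_gt0// mulrCA mulrC ler_wpM2r ?invr_ge0//.
  apply: le_trans (ler_wpM2l _ (qnormD _ _)) _; first by rewrite exprn_ge0 ?ltW.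
  by rewrite mulrDr lerD.
have dMN n : rho ^+ n * qnorm (odd_coef s n) <= (M + N) / 2 / t.
  rewrite ler_pdivlMr//.
  have -> : rho ^+ n * qnorm (odd_coef s n) * t =
      rho ^+ n * qnorm ((t *: qdir q) * odd_coef s n).
    by rewrite qnormM qnormZ (qnorm_sphere SJ) gtr0_norm// mulr1; ring.
  have -> : (t *: qdir q) * odd_coef s n =
     2^-1 *: ((ccoef q s n + (t *: qdir q) * odd_coef s n) -
     (ccoef q s n + (t *: - qdir q) * odd_coef s n)).
    by rewrite scalerN mulNr opprD opprK addrACA subrr add0r half_double.
  rewrite qnormZ gtr0_norm ?invr_gt0// mulrCA mulrC ler_wpM2r ?invr_ge0//.
  apply: le_trans (ler_wpM2l _ (qnormD _ _)) _; first by rewrite exprn_ge0 ?ltW.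
  by rewrite qnormN mulrDr lerD.
exists (Num.max ((M + N) / 2) ((M + N) / 2 / t)) => n.
  by rewrite le_max cMN.
by rewrite le_max dMN orbT.
Qed.

(** [Delta q x] commutes with [x - Re q], which can therefore be pulled out of the sum on the
    left. *)
Lemma spherical_sumE (f : quat R -> quat R) q s r x : 0 < r ->
  (forall x, Uball q r x ->
      series (fun n => Delta q x ^+ n * (s n.*2 + (x - q) * s n.*2.+1)) @ \oo
        --> f x) ->
  Uball q r x ->
  f x = qseries (ccoef q s) (Delta q x) +
    (x - (qRe q)%:A) * qseries (odd_coef s) (Delta q x).
Proof.
move=> r0 fs Ux; have [gc gd] := subgeometric_coefs r0 fs.
have cc := is_cvg_qseries gc Ux; have cd := is_cvg_qseries gd Ux.
apply: (cvg_unique (@norm_hausdorff _ _) (fs _ Ux)).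
set w := Delta q x in cc cd *; set Z := x - _%:A.
have Zw n : w ^+ n * Z = Z * w ^+ n.
  apply/esym/commrX; rewrite /w DeltaE; apply: commrD; first exact: commrX.
  by rewrite /GRing.comm mulr_algl mulr_algr.
have -> : series (fun n => w ^+ n * (s n.*2 + (x - q) * s n.*2.+1)) =
    (fun n => series (fun n => w ^+ n * ccoef q s n) n +
       Z * series (fun n => w ^+ n * odd_coef s n) n).
  apply/funext => n; rewrite /series/= big_distrr/= -big_split/=.
  by apply: eq_bigr => i _; rewrite ccoefE mulrDr mulrA Zw mulrA.
apply: cvgD; first exact: cc.
exact: (continuous_cvg _ (@qmul_continuous _ Z _) cd).
Qed.

(** Pointwise, so that it applies to the iterates, which are controlled only near [q]: just the
    values at two conjugate points enter. *)
Lemma sderiv_local (g : quat R -> quat R) z I (A B : quat R) :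
  qsphere I -> z.2 != 0 -> g (qpt z I) = A + I * B ->
  g (qpt z (- I)) = A - I * B -> sderiv g (qpt z I) = z.2^-1 *: B.
Proof.
move=> SI z0 gI; rewrite qptN /cconj => gN.
rewrite /sderiv qIm_qpt// qconj_qpt// gI gN opprD opprK addrACA subrr add0r.
have I0 : I \is a GRing.unit.
  by apply/unitrP; exists (- I); rewrite mulrN mulNr -expr2 SI opprK.
rewrite scalerA invrZ ?unitfE ?mulf_neq0 ?pnatr_eq0//.
by rewrite -scalerAl mulrDr !mulKr// invfM [_^-1 * _^-1]mulrC -scalerA half_double.
Qed.

Lemma cderiv_local (g : quat R -> quat R) (G : R * R -> quat R) z I :
  qsphere I -> 0 < z.2 -> (\forall w \near z, g (qpt w I) = G w) ->
  cderiv g (qpt z I) =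
    2^-1 *: ('D_((1, 0) : R * R) G z - I * 'D_((0, 1) : R * R) G z).
Proof.
move=> SI z0 gG; have e v : 'D_v (fun w => g (qpt w I)) z = 'D_v G z.
  exact: near_eq_derive.
have ez : qcoord (qpt z I) = z by apply: qcoord_qpt => //; exact: ltW.
have eI : qdir (qpt z I) = I by exact: qdir_qpt.
by move: e; rewrite /cderiv ez eI /dalpha /dbeta => e; rewrite e e.
Qed.

Lemma qcoord_mem (D : set (R * R)) q : symmetric_base D -> circularization D q ->
  D (qcoord q).
Proof.
move=> [_ symD] [z [I [Dz SI ->]]]; have [z0|z0] := leP 0 z.2.
  by rewrite qcoord_qpt.
(* In the lower half-plane, represent the same point by the conjugate coordinate and the opposite
   unit. *)
have -> : qpt z I = qpt (cconj z) (- I).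
  by rewrite qptN; case: z {Dz z0} => a b; rewrite /cconj/= opprK.
rewrite qcoord_qpt//=; first by rewrite -symD; exists z.
  exact: qsphereN.
by rewrite oppr_ge0 ltW.
Qed.

Lemma qcoord2_gt0 q : ~ qreal q -> 0 < (qcoord q).2.
Proof.
move=> nq; rewrite lt_neqAle qnorm_ge0 andbT eq_sym; apply/eqP => q0; apply: nq.
exists (qRe q); rewrite -[LHS](qRe_addIm q) (_ : qIm q = 0) ?addr0//.
by apply: qnorm_eq0; move: q0; rewrite /qcoord/= => ->; rewrite expr0n.
Qed.

End SphericalExpansion.

(** * The iterated derivatives of [f] near [q] and their values at [q] *)

Section IteratedDerivatives.
Context {R : realType}.
Context (D : set (R * R)) (f : quat R -> quat R) (q : quat R).
Context (F0 F1 : R * R -> quat R) (s : nat -> quat R) (r : R).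
Hypothesis symD : symmetric_base D.
Hypothesis holF : holomorphic_stem D F0 F1.
Hypothesis indF : Defs.induced D F0 F1 f.
Hypothesis Dq : circularization D q.
Hypothesis nrq : ~ qreal q.
Hypothesis r0 : 0 < r.
Hypothesis fs : forall x, Uball q r x ->
  series (fun n => Delta q x ^+ n * (s n.*2 + (x - q) * s n.*2.+1)) @ \oo
    --> f x.

Let J := qdir q.
Let z0 := qcoord q.
Let c := ccoef q s.
Let d := odd_coef s.
(** An open neighbourhood of [z0] on which both the stem function and the expansion describe [f]. *)
Let W : set (R * R) := D `&` Delta_disc q (r ^+ 2).

Let SJ : qsphere J := qdir_sphere q.
Let SNJ : qsphere (- J) := qsphereN SJ.
Let rr : 0 < r ^+ 2. Proof. by rewrite exprn_gt0. Qed.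
Let openW : open W.
Proof. by apply: openI; [exact: symD.1|exact: open_Delta_disc]. Qed.
Let subW : W `<=` Delta_disc q (r ^+ 2). Proof. by move=> z []. Qed.

Let nearW z : W z -> \forall w \near z, W w.
Proof. by move=> Wz; exact: open_nbhs_nbhs. Qed.

Let Wz0 : W z0.
Proof.
split; first exact: qcoord_mem.
split; first exact: qcoord2_gt0.
have -> : Delta_coord q z0 = 0.
  rewrite /Delta_coord /z0 /qcoord/= subrr mulr0 mul0r qnorm_qIm expr0n/=.
  by rewrite sub0r addNr.
by rewrite /= expr0n/= addr0 exprn_gt0.
Qed.

(** [slice I] is [f] on the slice of [I]. Combining the units [J] and [- J] recovers the stem
    function: [E0] is twice [F0], [E1] is [F1], and [G] is the spherical derivative of [f]. *)
Let slice I := Eadd (Eser I c) (Emul (Evar I) (Eser I d)).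
Let E0 := Eadd (slice J) (slice (- J)).
Let E1 := Emul (Ecst (- (2^-1 *: J)))
               (Eadd (slice J) (Emul (Ecst (-1)) (slice (- J)))).
Let G := Emul Einv E1.

Let wf_slice I : qsphere I -> wf (r ^+ 2) (slice I).
Proof.
by move=> SI; have [gc gd] := subgeometric_coefs r0 fs; do !split.
Qed.

Let wfE0 : wf (r ^+ 2) E0. Proof. by split; exact: wf_slice. Qed.
Let wfE1 : wf (r ^+ 2) E1.
Proof. by split=> //; split; [|split=> //]; exact: wf_slice. Qed.
Let wfG : wf (r ^+ 2) G. Proof. by split. Qed.

Let f_slice z I : qsphere I -> W z -> f (qpt z I) = eval q (slice I) z.
Proof.
move=> SI [_ Wz]; apply: (spherical_sumE r0 fs).
exact: Delta_disc_lt.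
Qed.

Let F0E z : W z -> F0 z = 2^-1 *: eval q E0 z.
Proof.
move=> Wz; have [Dz _] := Wz.
rewrite [eval q E0 z]/= -[_ + _ * _ in X in X + _]/(eval q (slice J) z).
rewrite -[X in _ + X]/(eval q (slice (- J)) z) -!f_slice// !indF//.
by rewrite mulNr addrACA subrr addr0 half_double.
Qed.

Let F1E z : W z -> F1 z = eval q E1 z.
Proof.
move=> Wz; have [Dz _] := Wz.
rewrite -[eval q E1 z]/((- (2^-1 *: J)) *
   (eval q (slice J) z + -1 * eval q (slice (- J)) z)).
rewrite -!f_slice// !indF// mulN1r [- J * _]mulNr opprD opprK addrACA subrr add0r.
by rewrite mulNr -scalerAl mulrDr mul_sphereK// half_double opprK.
Qed.

Let sderiv_f z I : W z -> qsphere I -> sderiv f (qpt z I) = eval q G z.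
Proof.
move=> Wz SI; have [Dz [z20 _]] := Wz.
rewrite (@sderiv_local _ _ _ _ (F0 z) (F1 z))//.
- by rewrite F1E// [eval q G z]/= mulr_algl.
- by rewrite gt_eqF.
- exact: indF.
- by rewrite indF ?mulNr//; exact: qsphereN.
Qed.

Let A : (quat R -> quat R) -> quat R -> quat R := cderiv \o sderiv.

Let cderiv_sderiv (g : quat R -> quat R) e : wf (r ^+ 2) e ->
  (forall z I, W z -> qsphere I -> sderiv g (qpt z I) = eval q e z) ->
  forall z I, W z -> qsphere I -> A g (qpt z I) =
    2^-1 *: (eval q (diff (1, 0) e) z - I * eval q (diff (0, 1) e) z).
Proof.
move=> we ge z I Wz SI; have [_ [z20 _]] := Wz.
rewrite /A/= (@cderiv_local _ _ (eval q e))//.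
  by rewrite !(derive_eval _ rr we (subW Wz)).
by apply: filterS (nearW Wz) => w Ww; exact: ge.
Qed.

(** By induction the spherical derivative does not depend on [I]. Hence the next [cderiv] has the
    components [X / 2] and [- Y / 2], and [sderiv] keeps the second one over [beta], which is
    [diffu]. *)
Let sderiv_iter k z I : W z -> qsphere I ->
  sderiv (iter k A f) (qpt z I) = eval q (iter k (@diffu R) G) z.
Proof.
elim: k z I => [|k IH] z I Wz SI; first exact: sderiv_f.
have [_ [z20 _]] := Wz; have wk := wf_iter_diffu k wfG.
pose X := eval q (diff (1, 0) (iter k (@diffu R) G)) z.
pose Y := eval q (diff (0, 1) (iter k (@diffu R) G)) z.
rewrite !iterS diffuE -/Y (@sderiv_local _ _ _ _ (2^-1 *: X) (- (2^-1 *: Y)))//.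
- by rewrite scalerN scalerA scaleNr mulrC.
- by rewrite gt_eqF.
- by rewrite (cderiv_sderiv wk IH)// -/X -/Y scalerBr mulrN scalerAr.
- rewrite (cderiv_sderiv wk IH)//; last exact: qsphereN.
  by rewrite -/X -/Y scalerBr mulrN mulNr scalerN !opprK scalerAr.
Qed.

Let slice_line z I : qsphere I -> z.1 = qRe q -> eval q (slice I) z =
  eval q (Eser J c) z + (z.2 *: I) * eval q (Eser J d) z.
Proof.
move=> SI za /=; rewrite !Delta_line//; congr (_ + _ * _).
by rewrite /qpt za addrC addKr.
Qed.

(** On this line [J] and [- J] give the same [Delta], so the series of [c] cancels in the
    difference; in [E0_line] the series of [d] cancels in the sum. *)
Let G_line z : W z -> z.1 = qRe q -> eval q G z = eval q (Eser J d) z.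
Proof.
move=> [_ [z20 _]] za.
rewrite -[eval q G z]/((z.2^-1)%:A * ((- (2^-1 *: J)) *
   (eval q (slice J) z + -1 * eval q (slice (- J)) z))).
rewrite !slice_line//; set C := eval q (Eser J c) z; set S := eval q (Eser J d) z.
rewrite mulN1r scalerN [- (_ *: J) * S]mulNr opprD opprK addrACA subrr add0r.
rewrite mulr_algl.
rewrite mulNr -scalerAl mulrDr -!scalerAl -!scalerAr mul_sphereK// half_double.
by rewrite !scalerN opprK scalerA mulVf ?scale1r// gt_eqF.
Qed.

Let E0_line z : W z -> z.1 = qRe q ->
  eval q E0 z = eval q (Eser J (fun n => c n *+ 2)) z.
Proof.
move=> Wz za; rewrite -[eval q E0 z]/(eval q (slice J) z + eval q (slice (- J)) z).
rewrite !slice_line// scalerN mulNr addrACA subrr addr0 /=.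
have [gc _] := subgeometric_coefs r0 fs.
have cc := is_cvg_qseries gc (Delta_disc_lt rr SJ (subW Wz)).
apply/esym/cvg_lim => //.
set w := Delta q _ in cc *.
have -> : series (fun n => w ^+ n * (c n *+ 2)) =
   (fun n => series (fun n => w ^+ n * c n) n + series (fun n => w ^+ n * c n) n).
  apply/funext => n; rewrite /series/= -big_split/=; apply: eq_bigr => i _.
  by rewrite mulrnAr mulr2n.
exact: cvgD.
Qed.

(** The Cauchy-Riemann equation divided by [beta]; the 2 in [diffu] is compensated by [E0] being
    twice [F0]. *)
Let diff_G z : W z -> eval q (diff (1, 0) G) z = eval q (diffu E0) z.
Proof.
move=> Wz; have [Dz [z20 _]] := Wz; have [_ CR] := holF Dz.
have e1 : dalpha F1 z = eval q (diff (1, 0) E1) z.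
  rewrite -(derive_eval _ rr wfE1 (subW Wz)); apply: near_eq_derive.
  by apply: filterS (nearW Wz) => w Ww; exact: F1E.
have e0 : dbeta F0 z = 2^-1 *: eval q (diff (0, 1) E0) z.
  pose H := Emul (Ecst (2^-1)%:A) E0; have wH : wf (r ^+ 2) H by split.
  transitivity (eval q (diff (0, 1) H) z).
    rewrite -(derive_eval _ rr wH (subW Wz)); apply: near_eq_derive.
    by apply: filterS (nearW Wz) => w Ww; rewrite F0E// [RHS]/= mulr_algl.
  by rewrite [LHS]/= mul0r add0r mulr_algl.
(* The first summand differentiates [1 / beta] along [alpha], hence vanishes. *)
rewrite -[LHS]/((- 0)%:A * ((z.2^-1)%:A * (z.2^-1)%:A) * eval q E1 z +
  (z.2^-1)%:A * eval q (diff (1, 0) E1) z).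
rewrite oppr0 scale0r !mul0r add0r mulr_algl -e1 -[dalpha _ _]opprK -CR e0 diffuE.
by rewrite scalerN scalerA -scaleNr mulrC.
Qed.

Let qpt0 : qpt z0 J = q. Proof. exact: qpt_qdir. Qed.

Let Delta0 : Delta q (qpt z0 J) = 0.
Proof. by rewrite Delta_line// subrr scale0r. Qed.

Let eval_G k : eval q (iter k (@diffu R) G) z0 = k`!%:R *: d k.
Proof.
have [_ gd] := subgeometric_coefs r0 fs.
exact: (eval_iter_diffu_line k rr openW subW wfG SJ gd G_line Wz0 erefl Delta0).
Qed.

Let eval_E0 k : eval q (iter k (@diffu R) E0) z0 = k`!%:R *: (c k *+ 2).
Proof.
have [gc _] := subgeometric_coefs r0 fs.
have gc2 : subgeometric (r ^+ 2) (fun n => c n *+ 2).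
  move=> rho /gc[M hM]; exists (M * 2) => n; rewrite -scaler_nat qnormZ normr_nat.
  by rewrite mulrCA mulrC ler_wpM2r.
exact: (eval_iter_diffu_line k rr openW subW wfE0 SJ gc2 E0_line Wz0 erefl Delta0).
Qed.

Lemma sderiv_iter_at k : sderiv (iter k A f) q = k`!%:R *: s k.*2.+1.
Proof. by rewrite -{1}qpt0 sderiv_iter// eval_G. Qed.

(** At order [k + 1], the [alpha] derivative contributes [(k+1)! c_(k+1)] and the [beta] derivative
    [(k+1)! Im(q) d_(k+1)]; by [cd] these add up to the even coefficient. *)
Lemma iter_cderiv_sderiv_at k : iter k A f q = k`!%:R *: s k.*2.
Proof.
have cd n : s n.*2 = c n + qIm q * d n by rewrite /c /ccoef subrK.
case: k => [|k].
  transitivity (f (qpt z0 J)); first by rewrite qpt0.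
  rewrite f_slice// slice_line// -qIm_dir /= Delta0 !qseries0.
  by rewrite fact0 scale1r cd.
have wk := wf_iter_diffu k wfG.
transitivity (A (iter k A f) (qpt z0 J)); first by rewrite qpt0 iterS.
rewrite (cderiv_sderiv wk (@sderiv_iter k) Wz0 SJ).
(* Move [d/dalpha] inside the iterated [diffu], where [diff_G] replaces it by one more [diffu],
   applied to [E0]. *)
rewrite (diff_iter_diffu k rr openW subW wfG) ?inE//.
rewrite (eval_iter_diffu_eq (e2 := diffu E0) k rr openW subW)//; last first.
- by rewrite inE.
- by move=> z; rewrite inE; exact: diff_G.
- exact: wf_diffu.
- exact: wf_diff.
rewrite -iterSr eval_E0.
have b0 : 0 < z0.2 by case: Wz0 => _ [].
(* Solve the definition of [diffu] for the [beta] derivative; the factor [beta] then combines with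
   [J] to [qIm q]. *)
have -> : eval q (diff (0, 1) (iter k (@diffu R) G)) z0 =
    (- (2 * z0.2)) *: eval q (iter k.+1 (@diffu R) G) z0.
  rewrite iterS diffuE scalerA [X in X *: _](_ : _ = 1) ?scale1r//.
  by field; rewrite gt_eqF.
rewrite eval_G cd -/z0 qIm_dir -/J -/z0 scaleNr mulrN opprK.
rewrite [c _ *+ 2]mulr2n [_ *: (c _ + c _)]scalerDr -!scalerAr -!scalerAl scalerDr.
rewrite half_double [RHS]scalerDr !scalerA; congr (_ + _ *: _).
by rewrite !mulrA mulVf ?mul1r ?pnatr_eq0// mulrC.
Qed.

End IteratedDerivatives.

Theorem theorem4p1 (R : realType) (D : set (R * R)) (f : quat R -> quat R)
    (q0 : quat R) (s : nat -> quat R)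
    (hD : symmetric_base D) (hf : slice_regular D f)
    (hq0 : (circularization D `\` qreal) q0)
    (hs : spherical_coefficients D f q0 s) (k : nat) :
  s k.*2 = (k`!%:R)^-1 *: iter k (cderiv \o sderiv) f q0 /\
  s k.*2.+1 = (k`!%:R)^-1 *: sderiv (iter k (cderiv \o sderiv) f) q0.
Proof.
have [F0 [F1 [_ _ _ holF indF]]] := hf.
have [Dq nrq] := hq0; have [r [r0 _ fs]] := hs.
have k0 : k`!%:R != 0 :> R by rewrite pnatr_eq0 -lt0n fact_gt0.
rewrite (iter_cderiv_sderiv_at hD holF indF Dq nrq r0 fs).
rewrite (sderiv_iter_at hD indF Dq nrq r0 fs).
by rewrite !scalerA mulVf// !scale1r.
Qed.
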